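(* For almost all $\beta\in(1,\sqrt2)$ and for almost all $x\in I_\beta$ we have that $$\lim_{n\to\infty}\left(\frac\beta2\right)^n|\mathcal O^n(x)|=h_\beta(x),$$ where $h_\beta$ denotes the density of the Bernoulli convolution $\nu_\beta$ with respect to Lebesgue measure.
   Context: ''Almost all'' is with respect to Lebesgue measure. For $\beta\in(1,2)$, $I_\beta=[0,\frac1{\beta-1}]$, and the Bernoulli convolution is the probability measure $\nu_\beta=m\circ\pi_\beta^{-1}$ on $I_\beta$, where $m$ is the $(\frac12,\frac12)$ Bernoulli measure on $\{0,1\}^{\mathbb N}$ and $\pi_\beta(\underline a)=\sum_{i\ge1}a_i\beta^{-i}$. (It is known that $\nu_\beta$ is absolutely continuous with continuous density for almost every $\beta\in(1,\sqrt2)$.) $T_i(x)=\beta x-i$ for $i\in\{0,1\}$ and $T_{a_1\cdots a_n}=T_{a_n}\circ\cdots\circ T_{a_1}$. $\mathcal O^n(x)$ is the multiset of points $T_{a_1\cdots a_n}(x)$ over all words $a_1\cdots a_n\in\{0,1\}^n$ with $T_{a_1\cdots a_n}(x)\in I_\beta$ (equivalently, words which begin some $\beta$-expansion of $x$, that is, some $\underline a\in\{0,1\}^{\mathbb N}$ with $\pi_\beta(\underline a)=x$), counted with multiplicity, so $|\mathcal O^n(x)|=|\{a_1\cdots a_n\in\{0,1\}^n:T_{a_1\cdots a_n}(x)\in I_\beta\}|$.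
   Formalization: The density h_β is taken with respect to Lebesgue measure on I_β normalised to total mass 1; with unnormalised Lebesgue measure the formula is false, since the limit is then 1/(β−1) times the density. *)

(* Defs.v *)
From mathcomp Require Import all_boot all_order all_algebra.
From mathcomp Require Import all_classical all_reals all_analysis.

Set Implicit Arguments.
Unset Strict Implicit.
Unset Printing Implicit Defensive.

Import Order.TTheory GRing.Theory Num.Theory.
Import numFieldNormedType.Exports.

Local Open Scope classical_set_scope.
Local Open Scope ring_scope.

Definition cylinder n (w : n.-tuple bool) : set (nat -> bool) :=
  [set a | forall i : 'I_n, a i = tnth w i].

Definition cylinders : set (set (nat -> bool)) :=
  [set C | exists n (w : n.-tuple bool), C = cylinder w].

(* {0,1}^N with its product sigma-algebra; [a i] is the digit a_{i+1}. *)
Definition digits := g_sigma_algebraType cylinders.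

(* The cylinders form a pi-system generating the sigma-algebra, so this
   determines m uniquely. *)
Definition is_bernoulli_half (R : realType) (m : probability digits R) : Prop :=
  forall n (w : n.-tuple bool), m (cylinder w) = ((2^-1 : R) ^+ n)%:E.

Section beta_expansions.
Context {R : realType}.
Implicit Types (b x : R) (m : probability digits R).

Definition Ibeta b : interval R := `[0, (b - 1)^-1].

Definition pibeta b (a : digits) : R :=
  limn (fun n => \sum_(0 <= i < n) (a i)%:R * b ^- i.+1).

Definition bernoulli_convolution m b : set (measurableTypeR R) -> \bar R :=
  pushforward m (pibeta b).

Definition Tdigit b x (i : bool) : R := b * x - i%:R.

(* [foldl] applies T_{a_1} first. *)
Definition Tword b (w : seq bool) x : R := foldl (Tdigit b) x w.

(* The multiset O^n(x), as a list. *)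
Definition Obeta b n x : seq R :=
  [seq y <- [seq Tword b (val w) x | w : n.-tuple bool] | y \in Ibeta b].

Lemma Ibeta_nondegenerate b : 1 < b -> 0 < (b - 1)^-1.
Proof. by move=> b1; rewrite invr_gt0 subr_gt0. Qed.

(* Lebesgue measure on I_beta, normalised to have total mass 1. The total mass
   matters: (b / 2) ^+ n * |O^n(x)| has integral |I_beta| = (b - 1)^-1 in dx for
   every n, while nu_beta has mass 1, so a density h with respect to dx cannot
   be the limit; the density with respect to this measure is (b - 1)^-1 * h. *)
Definition lebesgue_Ibeta b (b1 : 1 < b) : probability (measurableTypeR R) R :=
  uniform_prob (Ibeta_nondegenerate b1).

End beta_expansions.

Definition is_density d (T : measurableType d) (R : realType)
    (nu mu : set T -> \bar R) (h : T -> R) : Prop :=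
  [/\ measurable_fun setT h,
      forall x, 0 <= h x
    & forall A, measurable A -> nu A = (\int[mu]_(x in A) (h x)%:E)%E].

(* Main.v *)
Require Import Defs.
From HB Require Import structures.
From mathcomp Require Import all_boot all_order all_algebra.
From mathcomp Require Import all_classical all_reals all_analysis.
From mathcomp Require Import measurable_realfun.
From mathcomp Require Import ring lra zify.

Set Implicit Arguments.
Unset Strict Implicit.
Unset Printing Implicit Defensive.

Import Order.TTheory GRing.Theory Num.Theory.
Import numFieldNormedType.Exports.

Local Open Scope classical_set_scope.
Local Open Scope ring_scope.

(** Let [I = [0, L]] with [L = 1 / (b - 1)], and let [P f (x) = b / 2 * (f (b x) + f (b x - 1))] be
    the transfer operator. Apart from countably many [x], the normalised count
    [(b / 2)^n |O^n(x)|] is [f_n = P^n 1_[0, L)], so that [f_(n+1) - f_n = P^n g] for the step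
    function [g = P 1_[0, L) - 1_[0, L)], whose integral is zero. The whole proof consists in
    showing that the L2 norm of [P^n g] decays exponentially in [n] for almost every [b]. Absolute
    continuity of the Bernoulli convolution is then a consequence and not an ingredient.

    The squared norm of [P^n g] is [(b / 4)^n] times the sum of [G_b (p - p')] over all pairs of
    subset sums [p], [p'] of [1, b, .., b^(n-1)], where [G_b] is the autocorrelation of [g]
    ([increment_norm]). As [G_b] is positive definite, the parallelogram law bounds this sum by
    the one in which only the powers of [B = b^k] are kept, up to the factor 4 per dropped power
    ([diff_sum_subseq]). For [b < sqrt 2] some [k] satisfies [25/16 < b^k < 2]
    ([exists_exponent]). This range is what the next two steps need.

    After this reduction a difference [p - p'] is [q(B)] for a polynomial [q] with coefficients
    -1, 0, 1, and one may take [q] monic, of degree [M] say. For [B >= 25/16] the function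
    [B^(4 - M) q(B)] is strictly increasing, with a quantitative lower bound on its derivative
    ([eulerp_lower_bound]): this is the transversality property. It allows to integrate
    [b^n G_b(q(b^k))] by parts in [b]. Since [g] has integral zero, so does [G_b], and
    its primitive has compact support. The integral is therefore not only small because [q(B)] is
    rarely in the support of [G_b], but gains a second factor of the same size [b^(- k M)] from
    cancellation ([pair_bound]). Without the cancellation, the contribution of all pairs of degree
    [M] would be of the order of [(b^k / 2)^(N - M)], where [N] is the number of kept powers, and
    this does not decay when [M] is close to [N].

    Pairs with top exponent [M] have proportion [2^(M - N)] among all pairs. Since [B] stays
    between [25/16] and 2, the sum over [M] of all contributions is exponentially small
    ([energy_bound_exponential]), so for almost every [b] the energies decay exponentially
    ([ae_exponential_increments]). For such [b] a weighted sum of the squared increments is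
    integrable. Hence [f_n] converges almost everywhere and is dominated
    ([smoothed_count_converges]). The integral of [f_n] over a ray is [L] times a distribution
    function of prefixes of digit sequences, up to an error [L b^(- n)] in the endpoint, and this
    identifies the limit as the density ([limit_density_is_density]). *)

(** * Transversality for monic polynomials with coefficients in [-1, 1] *)

Section weighted_geometric.
Context {R : realFieldType}.

(** The numerical heart of transversality: the sum is close to 3.83 for large [M] when
    [x = 16 / 25], which is still below 4. From [l = 5] on, the absolute value is [l - 4] and the
    series can be summed in closed form. *)
Lemma weighted_geometric_bound (x : R) M : 0 <= x <= 16 / 25 ->
  \sum_(l < M) `|4 - l.+1%:R| * x ^+ l.+1 <= 31 / 8.
Proof.
move=> /andP[x0 xle].
apply: (@le_trans _ _ (\sum_(l < M) `|4 - l.+1%:R| * (16 / 25 : R) ^+ l.+1)).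
  apply: ler_sum => l _; apply: ler_wpM2l => //.
  by apply: lerXn2r; rewrite ?nnegrE //; lra.
pose y : R := 16 / 25.
(* Partial sums of the series of [l y^(l+4)], with the exact remainder: the numbers come from
   [1 / (1 - y) = 25 / 9] and [y / (1 - y)^2 = 400 / 81]. *)
have step n : \sum_(l < n) (l.+1%:R : R) * y ^+ (l + 5) +
    y ^+ (n + 5) * (n.+1%:R * (25 / 9) + 400 / 81) = y ^+ 5 * (625 / 81).
  elim: n => [|n IH]; first by rewrite big_ord0 add0r; lra.
  rewrite big_ord_recr /= -IH -addrA; congr (_ + _).
  rewrite addSn exprS -[n.+2%:R]natr1 /y; field=> //.
have small n : \sum_(l < n) (l.+1%:R : R) * y ^+ (l + 5) <= 17 / 20.
  have e := step n.
  have h : 0 <= y ^+ (n + 5) * (n.+1%:R * (25 / 9) + 400 / 81).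
    apply: mulr_ge0; first by apply: exprn_ge0; rewrite /y; lra.
    by apply: addr_ge0; [apply: mulr_ge0 => //; lra|lra].
  have := lexx (y ^+ 5 * (625 / 81) : R); rewrite -{1}e {e}.
  have y5 : y ^+ 5 <= 11 / 100.
    have y2 : y ^+ 2 <= 41 / 100 by rewrite /y; lra.
    have -> : y ^+ 5 = y ^+ 2 * (y ^+ 2 * y) by ring.
    apply: (@le_trans _ _ (41 / 100 * (41 / 100 * y))); last by rewrite /y; lra.
    by rewrite ler_pM ?exprn_ge0 ?mulr_ge0 ?ler_wpM2r ?exprn_ge0 // /y; lra.
  move: h y5; set A := y ^+ _ * _; set S := \sum_(_ < _) _; lra.
have y0 : 0 <= y by rewrite /y; lra.
rewrite -/y; apply: (@le_trans _ _ (\sum_(l < 4 + M) `|4 - l.+1%:R| * y ^+ l.+1)).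
  rewrite addnC big_split_ord /= lerDl.
  by apply: sumr_ge0 => l _; rewrite mulr_ge0 ?exprn_ge0.
rewrite big_split_ord /= !big_ord_recr big_ord0 /= add0r.
have -> : `|4 - 1%:R| = 3 :> R by rewrite ger0_norm; lra.
have -> : `|4 - 2%:R| = 2 :> R by rewrite ger0_norm; lra.
have -> : `|4 - 3%:R| = 1 :> R by rewrite ger0_norm; lra.
have -> : `|4 - 4%:R| = 0 :> R by rewrite subrr normr0.
have -> : \sum_(l < M) `|4 - (4 + l).+1%:R| * y ^+ (4 + l).+1 =
    \sum_(l < M) (l.+1%:R : R) * y ^+ (l + 5).
  apply: eq_bigr => l _; rewrite (_ : (4 + l).+1 = l + 5)%N; last by lia.
  congr (_ * _); rewrite (_ : (l + 5)%:R = l.+1%:R + 4 :> R); last first.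
    by rewrite -natrD addSn addnS.
  by rewrite opprD addrC -addrA addNr addr0 normrN ger0_norm.
have y2 : y ^+ 2 <= 41 / 100 by rewrite /y; lra.
have y3 : y ^+ 3 <= 41 / 100 * (16 / 25).
  by rewrite exprSr; apply: ler_pM; rewrite ?exprn_ge0.
have := small M; rewrite expr1.
move: (\sum_(l < M) _) y2 y3 => T.
have : y = 16 / 25 by [].
clear; clearbody y; move: (y ^+ 2) (y ^+ 3) (y ^+ 4) => z2 z3 z4 hy h2 h3 h4; rewrite hy; lra.
Qed.

End weighted_geometric.

Section transversality.
Context {R : realFieldType}.
Implicit Types (q : {poly R}) (B : R).

(** Up to a positive factor this is the derivative of [B^(4 - M) q(B)] with respect to [log B]. *)
Definition eulerp (M : nat) q : {poly R} := 'X * q^`() - (M%:R - 4)%:P * q.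

Lemma coef_eulerp M q i : (eulerp M q)`_i = (i%:R - M%:R + 4) * q`_i.
Proof.
rewrite /eulerp coefB coefXM coefCM coef_deriv.
case: i => [|i] /=; first ring.
rewrite -mulr_natr; ring.
Qed.

Lemma size_eulerp M q n : (size q <= n)%N -> (size (eulerp M q) <= n)%N.
Proof.
move=> qn; apply/leq_sizeP => j nj; rewrite coef_eulerp.
by move/leq_sizeP : qn => ->//; rewrite mulr0.
Qed.

(** Transversality. After division by [B^M] the leading term contributes exactly 4, and the other
    terms at most the sum of [|4 - l| B^(- l)], which is smaller than 4. The factor
    [B^(4 - M)] instead of [B^(- M)] is what makes this work: it changes the weight of [B^(- l)]
    from [l] to [|4 - l|] and provides the constant term. *)
Lemma eulerp_lower_bound M q B : (size q <= M.+1)%N -> q`_M = 1 ->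
  (forall i, `|q`_i| <= 1) -> 25 / 16 <= B ->
  B ^+ M / 8 <= (eulerp M q).[B].
Proof.
move=> sq qM q1 hB; have B0 : 0 < B by lra.
have hx : 0 <= B^-1 <= 16 / 25.
  rewrite invr_ge0 ltW //= invf_ple ?posrE //; lra.
rewrite (horner_coef_wide _ (size_eulerp M sq)) big_ord_recr /= coef_eulerp qM.
rewrite (_ : M%:R - M%:R + 4 = 4 :> R); last ring.
have : \sum_(i < M) (eulerp M q)`_i * B ^+ i >= - (31 / 8 * B ^+ M).
  rewrite lerNl -sumrN.
  apply: (@le_trans _ _ (\sum_(l < M) `|4 - l.+1%:R| * B^-1 ^+ l.+1 * B ^+ M)).
    rewrite [X in _ <= X](reindex_inj rev_ord_inj) /=.
    apply: ler_sum => i _; have iM := ltn_ord i.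
    rewrite (_ : (M - i.+1).+1 = M - i)%N; last by lia.
    have -> : B ^+ M = B ^+ (M - i) * B ^+ i by rewrite -exprD subnK // ltnW.
    rewrite -mulrA exprVn mulKf ?expf_neq0 ?gt_eqF //.
    rewrite -mulNr; apply: ler_wpM2r; first by rewrite exprn_ge0 // ltW.
    apply: (le_trans (ler_norm _)); rewrite normrN coef_eulerp normrM.
    rewrite -[leRHS]mulr1 ler_pM //.
    rewrite natrB ?(ltnW iM) // (_ : 4 - (M%:R - i%:R) = i%:R - M%:R + 4) //; ring.
  rewrite -mulr_suml; apply: ler_wpM2r; first by rewrite exprn_ge0 // ltW.
  exact: weighted_geometric_bound.
have := exprn_gt0 M B0; lra.
Qed.

Lemma eulerp_deriv_bound M q B s : (size q <= M.+1)%N ->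
  (forall i, `|q`_i| <= 1) -> 1 <= B -> M.+1%:R <= s ->
  `|(eulerp M q)^`().[B]| <= 4 * s ^+ 3 * B ^+ M.
Proof.
move=> sq q1 B1 hs.
have B0 : 0 <= B by lra.
have s1 : 1 <= s by rewrite (le_trans _ hs) // ler1n.
have sd : (size (eulerp M q)^`() <= M.+1)%N.
  apply: leq_trans (size_poly _ _) _; apply: leq_trans (leq_pred _) _.
  exact: size_eulerp.
rewrite (horner_coef_wide _ sd) (le_trans (ler_norm_sum _ _ _)) //.
apply: (@le_trans _ _ (\sum_(i < M.+1) (4 * s ^+ 2 * B ^+ M))).
  apply: ler_sum => i _; rewrite normrM (normrX _ B) (ger0_norm B0).
  apply: ler_pM => //; first exact: exprn_ge0.
    rewrite coef_deriv coef_eulerp -[X in `|X|]mulr_natr normrM normrM.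
    have [iM|iM] := ltnP i M; last first.
      have -> : q`_i.+1 = 0 by move/leq_sizeP : sq; apply; rewrite ltnS.
      by rewrite normr0 mulr0 mul0r mulr_ge0 // exprn_ge0 //; lra.
    rewrite (_ : 4 * s ^+ 2 = (4 * s * 1) * s); last ring.
    have iM' : (i.+1%:R : R) <= M%:R by rewrite ler_nat.
    have M1 : (M.+1%:R : R) = M%:R + 1 by rewrite -natr1.
    have i1 : (i.+1%:R : R) >= 1 by rewrite ler1n.
    apply: ler_pM; rewrite ?mulr_ge0 //; last by rewrite ger0_norm //; lra.
    apply: ler_pM => //.
    rewrite ler_norml; apply/andP; split; lra.
  by apply: ler_weXn2l => //; rewrite -ltnS.
rewrite sumr_const card_ord -[leLHS]mulr_natr.
rewrite (_ : 4 * s ^+ 3 * B ^+ M = 4 * s ^+ 2 * B ^+ M * s); last ring.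
apply: ler_wpM2l => //.
by rewrite !mulr_ge0 ?exprn_ge0 //; lra.
Qed.

End transversality.

(** * Upper bounds for integrals by primitives *)

Section derivatives.
Context {R : realType}.
Implicit Types (f g : R -> R) (x a b : R).

Lemma has_deriveM f g x a b : is_derive x 1 f a -> is_derive x 1 g b ->
  is_derive x 1 (fun y => f y * g y) (a * g x + f x * b).
Proof.
move=> hf hg; have -> : a * g x + f x * b = f x *: b + g x *: a.
  by rewrite addrC; congr (_ + _); rewrite mulrC.
exact: is_deriveM.
Qed.

Lemma has_deriveD f g x a b : is_derive x 1 f a -> is_derive x 1 g b ->
  is_derive x 1 (fun y => f y + g y) (a + b).
Proof. by move=> hf hg; apply: is_deriveD. Qed.

Lemma has_deriveV f x a : is_derive x 1 f a -> f x != 0 ->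
  is_derive x 1 (fun y => (f y)^-1) (- (a / f x ^+ 2)).
Proof.
move=> hf f0; have -> : - (a / f x ^+ 2) = - (f x) ^- 2 *: a.
  by rewrite /GRing.scale /= mulNr mulrC.
exact: is_deriveV.
Qed.

Lemma has_deriveX n x : is_derive x 1 (fun y : R => y ^+ n) (n%:R * x ^+ n.-1).
Proof.
have := is_derive_poly 'X^n x.
rewrite derivXn hornerMn hornerXn mulr_natl.
by rewrite (_ : horner 'X^n = fun y => y ^+ n) //; apply/funext => y; rewrite hornerXn.
Qed.

Lemma has_derive_comp f g x a b :
  is_derive (f x) 1 g b -> is_derive x 1 f a ->
  is_derive x 1 (fun y => g (f y)) (b * a).
Proof. by move=> hg hf; apply: is_derive1_comp. Qed.

Lemma has_derive_cst (c : R) x : is_derive x 1 (fun=> c) (0 : R).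
Proof. exact: is_derive_cst. Qed.

Lemma has_derive_id x : is_derive x 1 (fun y : R => y) (1 : R).
Proof. exact: is_derive_id. Qed.

Lemma has_derive_opp x : is_derive x 1 (fun y : R => - y) (- 1 : R).
Proof. exact: (is_deriveN (is_derive_id x 1)). Qed.

Lemma has_derive_poly_pow (p : {poly R}) k x :
  is_derive x 1 (fun y : R => p.[y ^+ k]) (p^`().[x ^+ k] * (k%:R * x ^+ k.-1)).
Proof. exact: (has_derive_comp (is_derive_poly p _) (has_deriveX k x)). Qed.

Lemma has_derive_val f x a : is_derive x 1 f a -> 'D_1 f x = a.
Proof. by case. Qed.

Lemma has_derive_continuous f x a : is_derive x 1 f a -> {for x, continuous f}.
Proof. by move=> [df _]; apply/differentiable_continuous/derivable1_diffP. Qed.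

End derivatives.

Section primitive_bounds.
Context {R : realType}.
Variables (a b : R).

(** The integral of [u] over [[a, b]] is at most [K], expressed through some [V] whose derivative
    dominates [u]. In this form upper bounds add up, and nothing has to be known about the
    regularity of [u]. *)
Definition integral_le (u : R -> R) (K : R) := exists V V' : R -> R,
  [/\ forall x, a <= x <= b -> is_derive x 1 V (V' x),
      forall x, a <= x <= b -> u x <= V' x
    & V b - V a <= K].

Lemma integral_leD u v K L : integral_le u K -> integral_le v L ->
  integral_le (fun x => u x + v x) (K + L).
Proof.
move=> [U [U' [dU uU hU]]] [V [V' [dV vV hV]]].
exists (fun x => U x + V x), (fun x => U' x + V' x); split.
- by move=> x xab; apply: has_deriveD; auto.
- by move=> x xab; apply: lerD; auto.
- lra.
Qed.

Lemma integral_leZ u K c : 0 <= c -> integral_le u K ->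
  integral_le (fun x => c * u x) (c * K).
Proof.
move=> c0 [U [U' [dU uU hU]]].
exists (fun x => c * U x), (fun x => c * U' x); split.
- move=> x xab; have := has_deriveM (has_derive_cst c x) (dU x xab).
  by rewrite mul0r add0r.
- by move=> x xab; apply: ler_wpM2l; auto.
- by rewrite -mulrBr ler_wpM2l.
Qed.

Lemma integral_le_trans u v K L : integral_le v K ->
  (forall x, a <= x <= b -> u x <= v x) -> K <= L -> integral_le u L.
Proof.
move=> [U [U' [dU uU hU]]] uv KL; exists U, U'; split => //; last exact: le_trans KL.
by move=> x xab; apply: le_trans (uv _ xab) (uU _ xab).
Qed.

Lemma integral_le_cst c K : c * (b - a) <= K -> integral_le (fun=> c) K.
Proof.
move=> hK; exists (fun x => c * x), (fun=> c); split => //; last by rewrite -mulrBr.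
move=> x _; have := has_deriveM (has_derive_cst c x) (has_derive_id x).
by rewrite mul0r add0r mulr1.
Qed.

Lemma integral_le_sum (I : Type) (r : seq I) (u : I -> R -> R) (K : I -> R) :
  (forall i, integral_le (u i) (K i)) ->
  integral_le (fun x => \sum_(i <- r) u i x) (\sum_(i <- r) K i).
Proof.
move=> h; elim: r => [|i r IH].
  rewrite big_nil; apply: (@integral_le_trans _ (fun=> 0) 0 0) => //.
    by apply: integral_le_cst; rewrite mul0r.
  by move=> x _; rewrite big_nil.
rewrite big_cons; apply: (integral_le_trans (integral_leD (h i) IH)) => // x _.
by rewrite big_cons.
Qed.

(** [V] grows at least as fast as the primitive of [u], by the mean value theorem. *)
Lemma integral_leP u K : a < b -> (forall x, a <= x <= b -> {for x, continuous u}) ->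
  integral_le u K ->
  (\int[lebesgue_measure]_(x in `[a, b]) (u x)%:E <= K%:E)%E.
Proof.
move=> ab cu [V [V' [dV uV hV]]].
have wu : {within `[a, b], continuous u}.
  apply: continuous_in_subspaceT => x; rewrite inE /= in_itv /=; exact: cu.
have iu : lebesgue_measure.-integrable `[a, b] (EFin \o u).
  by apply: continuous_compact_integrable => //; exact: segment_compact.
pose U x := \int[lebesgue_measure]_(t in `[a, x]) u t.
have cU : {within `[a, b], continuous U}.
  exact: parameterized_integral_continuous (ltW ab) iu.
have dU x : x \in `]a, b[ -> is_derive x 1 U (u x).
  rewrite in_itv /= => /andP[ax xb].
  have [|h1 h2] := @continuous_FTC1_closed R u a x b xb iu ax.
    by apply: cu; rewrite !ltW.
  by apply: DeriveDef; [exact: h1|rewrite -derive1E; exact: h2].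
have cV : {within `[a, b], continuous V}.
  apply: continuous_in_subspaceT => x; rewrite inE /= in_itv /= => xab.
  exact: has_derive_continuous (dV _ xab).
have : U b - U a <= V b - V a.
  have dW x : x \in `]a, b[ -> is_derive x 1 (fun y => V y + - U y) (V' x - u x).
    move=> xab; apply: has_deriveD.
      by apply: dV; move: xab; rewrite in_itv /= => /andP[ax xb]; rewrite !ltW.
    exact: is_deriveN (dU _ xab).
  have [|c cab] := MVT_segment (ltW ab) dW.
    move=> x; apply: continuousB; [exact: cV|exact: cU].
  have : 0 <= V' c - u c.
    by rewrite subr_ge0 uV //; move: cab; rewrite in_itv.
  move=> h e; have : 0 <= (V' c - u c) * (b - a) by rewrite mulr_ge0 // subr_ge0 ltW.
  by rewrite -e; lra.
rewrite {2}/U set_itv1 Rintegral_set1 subr0 => h.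
have -> : (\int[lebesgue_measure]_(x in `[a, b]) (u x)%:E = (U b)%:E)%E.
  by rewrite /U /Rintegral fineK // integrable_fin_num.
by rewrite lee_fin; exact: le_trans h hV.
Qed.

End primitive_bounds.

(** * Integration by parts along a transversal polynomial *)

Section by_parts.
Context {R : realType}.
Variables (k M : nat) (s : R) (q : {poly R}).
Hypotheses (k_gt0 : (0 < k)%N) (sM : M.+1%:R <= s) (size_q : (size q <= M.+1)%N)
  (lead_q : q`_M = 1) (coef_q : forall i, `|q`_i| <= 1).

Let Z y : R := (eulerp M q).[y ^+ k].
Let dQ y : R := q^`().[y ^+ k] * (k%:R * y ^+ k.-1).

(** With [Q y = q(y^k)] and [Z] its modified derivative, [y Q' = k (Z + (M - 4) Q)]. Dividing by
    [k Z], which is safe by transversality, turns [g Q' w] into [g w] up to the term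
    [(M - 4) g Q w / Z]. That term is small because [g] lives where [Q] is bounded while [Z] is
    of size [y^(k M)]. The remaining terms of the derivative carry the same factor
    [y^(- k M)]. *)
Lemma by_parts_derivative (T w : R -> R) (x g e w' c om om' : R) :
  1 <= x -> x <= 2 -> 25 / 16 <= x ^+ k -> x ^+ k <= 2 ->
  is_derive x 1 T (g * dQ x + e) -> is_derive x 1 w w' ->
  `|g * q.[x ^+ k]| <= c -> `|e| <= c -> `|T x| <= c ->
  `|w x| <= om -> `|w'| <= om' ->
  exists D, is_derive x 1 (fun y => T y * (w y * y) * (k%:R * Z y)^-1) D /\
    `|D - g * w x| <= c * (8 / x ^+ (k * M)) * s ^+ 3 * (135 * om + 2 * om').
Proof.
move=> x1 x2 B1 B2 hT hw hg he hTx hwx hw'.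
have k0 : 0 < (k%:R : R) by rewrite ltr0n.
have B0 : 0 < x ^+ k by lra.
set P : R := x ^+ (k * M).
have PB : P = (x ^+ k) ^+ M by rewrite /P exprM.
have P0 : 0 < P by rewrite PB exprn_gt0.
have hZ : P / 8 <= Z x by rewrite PB; apply: eulerp_lower_bound.
have Z0 : 0 < Z x by lra.
have s1 : 1 <= s by rewrite (le_trans _ sM) // ler1n.
set dZ := (eulerp M q)^`().[x ^+ k] * (k%:R * x ^+ k.-1).
have hdZ : `|dZ| <= 8 * k%:R * s ^+ 3 * P.
  rewrite /dZ normrM (_ : 8 * k%:R * s ^+ 3 * P = 4 * s ^+ 3 * P * (k%:R * 2)); last ring.
  apply: ler_pM => //.
    by rewrite PB; apply: eulerp_deriv_bound => //; lra.
  rewrite ger0_norm ?mulr_ge0 ?exprn_ge0 //; try lra.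
  apply: ler_wpM2l; first exact: ltW.
  by apply: le_trans B2; apply: ler_weXn2l => //; rewrite leq_pred.
have dZx : is_derive x 1 Z dZ := has_derive_poly_pow (eulerp M q) k x.
have xdQ : dQ x * x = k%:R * (Z x + (M%:R - 4) * q.[x ^+ k]).
  rewrite /Z /eulerp hornerD hornerN !hornerM hornerX hornerC /dQ.
  have Bk : x ^+ k = x ^+ k.-1 * x by rewrite -exprSr prednK.
  move: (q^`().[x ^+ k]) (q.[x ^+ k]) => d v; rewrite Bk; ring.
have h1 := has_deriveM hT (has_deriveM hw (has_derive_id x)).
have h2 := has_deriveM (has_derive_cst (k%:R : R) x) dZx.
have kZ0 : k%:R * Z x != 0 by rewrite mulf_neq0 ?gt_eqF.
have h3 := has_deriveV h2 kZ0.
have h4 := has_deriveM h1 h3.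
eexists; split; first exact: h4.
set Qx := q.[x ^+ k] in hg xdQ *.
have -> : ((g * dQ x + e) * (w x * x) + T x * (w' * x + w x * 1)) / (k%:R * Z x) +
   T x * (w x * x) * - ((0 * Z x + k%:R * dZ) / (k%:R * Z x) ^+ 2) - g * w x =
   (Z x)^-1 * ((g * Qx) * ((M%:R - 4) * w x) + e * (w x * (x / k%:R)) + T x * ((w' * x + w x) / k%:R)
     - T x * (w x * (x * (dZ / (k%:R * Z x))))).
  have -> : (g * dQ x + e) * (w x * x) = g * w x * (dQ x * x) + e * (w x * x) by ring.
  rewrite xdQ; field; rewrite !gt_eqF //.
have iZ : (Z x)^-1 <= 8 / P.
  by rewrite -[leRHS]invrK lef_pV2 ?posrE ?invr_gt0 ?divr_gt0 // invf_div.
have k1 : 1 <= (k%:R : R) by rewrite ler1n.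
have ik0 : 0 <= (k%:R : R)^-1 by rewrite invr_ge0 ltW.
have ik1 : (k%:R : R)^-1 <= 1 by rewrite invf_le1.
rewrite normrM.
rewrite (_ : c * (8 / P) * s ^+ 3 * (135 * om + 2 * om') =
             (8 / P) * (c * (s ^+ 3 * (135 * om + 2 * om')))); last ring.
have iZ0 : 0 <= (Z x)^-1 by rewrite invr_ge0 ltW.
apply: ler_pM => //; first by rewrite ger0_norm.
have om0 : 0 <= om := le_trans (normr_ge0 _) hwx.
have om'0 : 0 <= om' := le_trans (normr_ge0 _) hw'.
have c0 : 0 <= c := le_trans (normr_ge0 _) hTx.
have s3 : s <= s ^+ 3 by rewrite -{1}[s]expr1; apply: ler_weXn2l.
have A1 : `|g * Qx * ((M%:R - 4) * w x)| <= c * (4 * s ^+ 3 * om).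
  rewrite normrM; apply: ler_pM => //; rewrite normrM; apply: ler_pM => //.
  have M0 : 0 <= (M%:R : R) by [].
  have M1 : M%:R + 1 <= s by rewrite natr1.
  by move: M0 M1 s3; move: (M%:R : R) (s ^+ 3) => m s3' *; rewrite ler_norml; apply/andP; split; lra.
have A2 : `|e * (w x * (x / k%:R))| <= c * (om * 2).
  rewrite normrM; apply: ler_pM => //; rewrite normrM; apply: ler_pM => //.
  rewrite ger0_norm ?mulr_ge0 //; try lra.
  by rewrite -[leRHS]mulr1; apply: ler_pM => //; lra.
have A3 : `|T x * ((w' * x + w x) / k%:R)| <= c * (om' * 2 + om).
  rewrite normrM; apply: ler_pM => //; rewrite normrM -[leRHS]mulr1.
  apply: ler_pM => //; last by rewrite ger0_norm.
  apply: le_trans (ler_normD _ _) _; apply: lerD => //.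
  by rewrite normrM; apply: ler_pM => //; rewrite ger0_norm; lra.
have A4 : `|T x * (w x * (x * (dZ / (k%:R * Z x))))| <= c * (om * (2 * (64 * s ^+ 3))).
  rewrite normrM; apply: ler_pM => //; rewrite normrM; apply: ler_pM => //.
  rewrite normrM; apply: ler_pM => //; first by rewrite ger0_norm; lra.
  rewrite normrM normfV (ger0_norm (_ : 0 <= k%:R * Z x)); last first.
    by rewrite mulr_ge0 ?ltW.
  rewrite ler_pdivrMr ?mulr_gt0 //.
  apply: le_trans hdZ _.
  rewrite (_ : 64 * s ^+ 3 * (k%:R * Z x) = 8 * k%:R * s ^+ 3 * (8 * Z x)); last ring.
  apply: ler_wpM2l; last lra.
  by rewrite !mulr_ge0 ?exprn_ge0 //; lra.
apply: le_trans (ler_normB _ _) _.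
apply: le_trans (lerD (le_trans (ler_normD _ _) (lerD (ler_normD _ _) (lexx _))) (lexx _)) _.
apply: le_trans (lerD (lerD (lerD A1 A2) A3) A4) _.
rewrite -!mulrDr; apply: ler_wpM2l => //.
have s31 : 1 <= s ^+ 3 by rewrite (le_trans s1).
have : om * 1 <= om * s ^+ 3 by rewrite ler_wpM2l.
have : om' * 1 <= om' * s ^+ 3 by rewrite ler_wpM2l.
move: (s ^+ 3) => s3'; lra.
Qed.
End by_parts.

(** * Averaging a kernel over the base for one pair of words *)

Section signed_sums.
Context {R : pzRingType}.
Implicit Types (c : seq R) (f : R -> R).

(** Sum of [f] over the differences of two subset sums of [c]: an element of [c] cancels in two
    ways, and occurs with either sign in one way. *)
Fixpoint diff_sum c f : R :=
  if c is d :: c' then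
    2 * diff_sum c' f + diff_sum c' (fun t => f (t + d)) +
    diff_sum c' (fun t => f (t - d))
  else f 0.

Fixpoint powers (B : R) n : seq R :=
  if n is m.+1 then B ^+ m :: powers B m else [::].

End signed_sums.

Section signed_sums_theory.
Context {R : comPzRingType}.
Implicit Types (c : seq R) (f : R -> R).

Lemma eq_diff_sum c f g : f =1 g -> diff_sum c f = diff_sum c g.
Proof.
elim: c f g => [|d c IH] f g fg /=; first exact: fg.
rewrite (IH _ _ fg); congr (_ + _ + _); apply: IH => t; exact: fg.
Qed.

Lemma diff_sum_even c f (d : R) : (forall t, f (- t) = f t) ->
  diff_sum c (fun t => f (t - d)) = diff_sum c (fun t => f (t + d)).
Proof.
elim: c f d => [|e c IH] f d fe /=.
  by rewrite -fe opprB subr0 add0r.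
rewrite IH // -!addrA; congr (_ + _); rewrite addrC.
have h1 := IH f (d - e) fe; have h2 := IH f (d + e) fe.
congr (_ + _).
  rewrite (eq_diff_sum _ (g := fun t => f (t - (d + e)))); last first.
    by move=> t /=; rewrite opprD addrA (addrAC t).
  by rewrite h2; apply: eq_diff_sum => t /=; rewrite addrA (addrAC t).
rewrite (eq_diff_sum _ (g := fun t => f (t - (d - e)))); last first.
  by move=> t /=; rewrite opprB addrA.
by rewrite h1; apply: eq_diff_sum => t /=; rewrite addrA (addrAC t).
Qed.

(** Pairs are sorted by the largest exponent [M] at which they differ. By evenness the sign of
    that difference does not matter. *)
Lemma diff_sum_powers B N f : (forall t, f (- t) = f t) ->
  diff_sum (powers B N) f = 2 ^+ N * f 0 +
    \sum_(M < N) 2 ^+ (N - M) * diff_sum (powers B M) (fun t => f (t + B ^+ M)).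
Proof.
move=> fe; elim: N => [|N IH] /=; first by rewrite big_ord0 expr0 mul1r addr0.
rewrite big_ord_recr /= subSnn expr1 diff_sum_even // -addrA -mulr2n -[diff_sum _ _ *+ 2]mulr_natl.
rewrite IH mulrDr. rewrite (mulrA _ (2 ^+ N)) -exprS -addrA; congr (_ + _).
rewrite addrC [in RHS]addrC; congr (_ + _).
rewrite mulr_sumr; apply: eq_bigr => M _; rewrite mulrA -exprS subSn //.
exact: ltnW.
Qed.

End signed_sums_theory.

Section pair_bound.
Context {R : realType}.
Variables (a b : R) (k : nat).
Hypotheses (k_gt0 : (0 < k)%N) (a_ge1 : 1 <= a) (ab : a < b) (b_le : b <= 2)
  (ba1 : b - a <= 1) (ak : 25 / 16 <= a ^+ k) (bk : b ^+ k <= 2).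

Let ab_range : [/\ 1 <= a, a < b, b <= 2 & b - a <= 1]. Proof. by split. Qed.

Let in_range x : a <= x <= b ->
  [/\ 1 <= x, x <= 2, 25 / 16 <= x ^+ k & x ^+ k <= 2].
Proof.
have [? ? ? ?] := ab_range; move=> /andP[ax xb]; split; try lra.
  by apply: le_trans ak _; apply: lerXn2r; rewrite ?nnegrE //; lra.
by apply: le_trans bk; apply: lerXn2r; rewrite ?nnegrE //; lra.
Qed.

Let pow_le n x : a <= x <= b -> a ^+ n <= x ^+ n.
Proof.
have [? ? ? ?] := ab_range.
by move=> /andP[ax xb]; apply: lerXn2r; rewrite ?nnegrE //; lra.
Qed.

Section one_polynomial.
Variables (M : nat) (s : R) (q : {poly R}).
Hypotheses (sM : M.+1%:R <= s) (size_q : (size q <= M.+1)%N)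
  (lead_q : q`_M = 1) (coef_q : forall i, `|q`_i| <= 1).

Let Z y : R := (eulerp M q).[y ^+ k].

Let invZ x : a <= x <= b -> 0 <= (k%:R * Z x)^-1 <= 8 / a ^+ (k * M).
Proof.
have [? ? ? ?] := ab_range.
move=> xab; have [x1 x2 B1 B2] := in_range xab.
have k1 : 1 <= (k%:R : R) by rewrite ler1n.
have P0 : 0 < a ^+ (k * M) by rewrite exprn_gt0 //; lra.
have hZ : x ^+ (k * M) / 8 <= Z x by rewrite exprM; apply: eulerp_lower_bound.
have aZ : a ^+ (k * M) / 8 <= Z x.
  by apply: le_trans hZ; rewrite ler_wpM2r // pow_le.
have Z0 : 0 < Z x by apply: lt_le_trans aZ; rewrite divr_gt0.
have kZ0 : 0 < k%:R * Z x by rewrite mulr_gt0 //; lra.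
rewrite invr_ge0 ltW //= -[leRHS]invrK lef_pV2 ?posrE ?invr_gt0 ?divr_gt0 //.
rewrite invf_div; apply: le_trans aZ _.
by rewrite -[leLHS]mul1r ler_wpM2r // ltW.
Qed.

Let pow_ge1 n : 1 <= a ^+ n. Proof. exact: exprn_ege1. Qed.

Let inva n x : a <= x <= b -> 8 / x ^+ n <= 8 / a ^+ n.
Proof.
move=> xab; have [x1 _ _ _] := in_range xab.
rewrite ler_wpM2l // lef_pV2 ?posrE; last 2 first.
  by rewrite (lt_le_trans ltr01) // exprn_ege1.
  by rewrite (lt_le_trans ltr01).
exact: pow_le.
Qed.

(** [q(x^k)] crosses the bounded region at speed about [a^(k M)]. Integrating by parts against
    the arctangent turns this into a bound of that order. The majorant [1 / (1 + t^2)] is a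
    convenient substitute for the indicator of a bounded set. *)
Lemma integral_cauchy_density :
  integral_le a b (fun x => (1 + q.[x ^+ k] ^+ 2)^-1)
    ((270 * s ^+ 3 + 8) * (8 / a ^+ (k * M))).
Proof.
have [? ? ? ?] := ab_range.
pose V y : R := atan q.[y ^+ k] * (1 * y) * (k%:R * Z y)^-1.
have s0 : 0 <= s by rewrite (le_trans _ sM).
have atan2 t : `|atan t| <= 2 :> R.
  have := atan_gtNpi2 t; have := atan_ltpi2 t; have := @pihalf_lt2 R.
  by move=> h1 h2 h3; rewrite ler_norml; apply/andP; split; lra.
have A (x : R) : a <= x <= b -> exists D, is_derive x 1 V D /\
    `|D - (1 + q.[x ^+ k] ^+ 2)^-1| <= 270 * s ^+ 3 * (8 / a ^+ (k * M)).
  move=> xab; have [x1 x2 B1 B2] := in_range xab.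
  set t := q.[x ^+ k].
  have t0 : 0 < 1 + t ^+ 2 by rewrite ltr_pwDl // sqr_ge0.
  have hT := @has_derive_comp _ (fun y => q.[y ^+ k]) atan x _ _
    (is_derive1_atan t) (has_derive_poly_pow q k x).
  rewrite -[X in is_derive _ _ _ X]addr0 in hT.
  have := @by_parts_derivative R k M s q k_gt0 sM size_q lead_q coef_q
    _ (fun=> 1) x _ 0 0 2 1 0 x1 x2 B1 B2 hT (has_derive_cst 1 x).
  case => //.
  - rewrite normrM normfV (gtr0_norm t0) mulrC ler_pdivrMr // -/t.
    have := sqr_ge0 (`|t| - 1); have := sqr_ge0 t; rewrite -real_normK ?num_real //.
    by move: `|t| => u; nra.
  - by rewrite normr0.
  - by rewrite normr1.
  - by rewrite normr0.
  move=> D [hD hb]; exists D; split => //.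
  move: hb; rewrite mulr1 => /le_trans; apply.
  rewrite (_ : 270 * s ^+ 3 * (8 / a ^+ (k * M)) =
    2 * (8 / a ^+ (k * M)) * s ^+ 3 * (135 * 1 + 2 * 0)); last ring.
  rewrite !ler_wpM2r ?exprn_ge0 //; try lra.
  by rewrite ler_wpM2l // inva.
have iP0 : 0 <= 8 / a ^+ (k * M) by rewrite divr_ge0 // (le_trans ler01).
rewrite (mulrDl (270 * _)) addrC.
apply: (@integral_le_trans _ _ _ _
  (fun x => 'D_1 V x + 270 * s ^+ 3 * (8 / a ^+ (k * M)))); last exact: lexx.
  apply: integral_leD.
    exists V, ('D_1 V); split => //.
      by move=> x /A[D [hD _]]; rewrite (has_derive_val hD).
    have Vb x : a <= x <= b -> `|V x| <= 4 * (8 / a ^+ (k * M)).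
      move=> xab; have /andP[i0 i1] := invZ xab; have [x1 x2 B1 B2] := in_range xab.
      rewrite /V normrM; apply: ler_pM => //; last by rewrite ger0_norm.
      rewrite normrM (_ : 4 = 2 * 2 :> R); last ring.
      by apply: ler_pM => //; rewrite mul1r ger0_norm; lra.
    have : `|V b| <= 4 * (8 / a ^+ (k * M)) by apply: Vb; rewrite lexx ltW.
    have : `|V a| <= 4 * (8 / a ^+ (k * M)) by apply: Vb; rewrite lexx ltW.
    by rewrite !ler_norml => /andP[? ?] /andP[? ?]; lra.
  apply: integral_le_cst; rewrite -[leRHS]mulr1; apply: ler_wpM2l; last exact: ba1.
  exact: mulr_ge0 (mulr_ge0 (ler0n _ _) (exprn_ge0 _ s0)) iP0.
move=> x /A[D [hD]]; rewrite (has_derive_val hD) ler_norml => /andP[h _]; lra.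
Qed.

Section kernel.
Variables (C : R) (G H E : R -> R -> R).
Hypotheses
  (dH : forall x Q dQ, a <= x <= b -> is_derive x 1 Q dQ ->
     is_derive x 1 (fun y => H y (Q y)) (G x (Q x) * dQ + E x (Q x)))
  (bG : forall x t, a <= x <= b -> `|G x t * t| <= C / (1 + t ^+ 2))
  (bH : forall x t, a <= x <= b -> `|H x t| <= C / (1 + t ^+ 2))
  (bE : forall x t, a <= x <= b -> `|E x t| <= C / (1 + t ^+ 2)).

Definition pair_constant n : R :=
  C * (8 * 137 * s ^+ 4 * (b ^+ (n - k * M)%N)) *
  ((270 * s ^+ 3 + 8) * (8 / a ^+ (k * M))).

(** [H] is a primitive of [G] in the second variable and decays as [G] does, so one integration
    by parts gains the factor [x^(- k M)], and the error still contains a kernel of size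
    [1 / (1 + q(x^k)^2)], whose integral gains that factor a second time. The weight
    [(x - a) (b - x)] removes the boundary terms. *)
Lemma pair_bound n : (k * M <= n)%N -> n.+1%:R <= s ->
  integral_le a b
    (fun x => x ^+ n * ((x - a) * (b - x)) * G x q.[x ^+ k])
    (pair_constant n).
Proof.
move=> kMn sn; have [? ? ? ?] := ab_range.
have s1 : 1 <= s by rewrite (le_trans _ sn) // ler1n.
pose w y : R := y ^+ n * ((y - a) * (b - y)).
pose V y : R := H y q.[y ^+ k] * (w y * y) * (k%:R * Z y)^-1.
pose c x := C / (1 + q.[x ^+ k] ^+ 2).
have C0 : 0 <= C.
  have := le_trans (normr_ge0 _) (bH 0 (_ : a <= a <= b)).
  by rewrite lexx ltW // expr0n addr0 divr1; apply.
have c0 x : 0 <= c x by rewrite divr_ge0 // addr_ge0 // sqr_ge0.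
have A (x : R) : a <= x <= b -> exists D, is_derive x 1 V D /\
    `|D - G x q.[x ^+ k] * w x| <= c x * (8 * 137 * s ^+ 4 * b ^+ (n - k * M)).
  move=> xab; have [x1 x2 B1 B2] := in_range xab.
  have xn0 : 0 <= x ^+ n by rewrite exprn_ge0; lra.
  have hT := dH xab (has_derive_poly_pow q k x).
  have hw := has_deriveM (has_deriveX n x)
    (has_deriveM (has_deriveD (has_derive_id x) (has_derive_cst (- a) x))
       (has_deriveD (has_derive_cst b x) (has_derive_opp x))).
  have /andP[ax xb] := xab.
  have p0 : 0 <= (x - a) * (b - x) by rewrite mulr_ge0; lra.
  have p1 : (x - a) * (b - x) <= 1.
    by rewrite -[leRHS]mulr1; apply: ler_pM; lra.
  have hwx : `|w x| <= x ^+ n.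
    by rewrite ger0_norm; [exact: ler_piMr|exact: mulr_ge0].
  have := @by_parts_derivative R k M s q k_gt0 sM size_q lead_q coef_q
    _ w x _ _ _ (c x) (x ^+ n) (s * x ^+ n) x1 x2 B1 B2 hT hw
    (bG q.[x ^+ k] xab) (bE q.[x ^+ k] xab) (bH q.[x ^+ k] xab) hwx.
  case.
    apply: le_trans (ler_normD _ _) _.
    have sn' : n%:R + 1 <= s by rewrite natr1.
    apply: (@le_trans _ _ (n%:R * x ^+ n + x ^+ n)); last first.
      rewrite -[X in _ + X]mul1r -mulrDl; apply: ler_wpM2r => //.
    apply: lerD.
      rewrite normrM (ger0_norm p0) -[leRHS]mulr1; apply: ler_pM => //.
      rewrite ger0_norm ?mulr_ge0 // ?exprn_ge0 //; try lra.
      by rewrite ler_wpM2l // ler_weXn2l // leq_pred.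
    rewrite normrM (ger0_norm xn0) -[leRHS]mulr1 ler_wpM2l //.
    rewrite ler_norml; apply/andP; split; lra.
  move=> D [hD hb]; exists D; split => //; apply: le_trans hb _.
  have -> : c x * (8 / x ^+ (k * M)) * s ^+ 3 * (135 * x ^+ n + 2 * (s * x ^+ n)) =
     c x * (8 * (135 + 2 * s) * s ^+ 3 * (x ^+ n / x ^+ (k * M))) by ring.
  apply: ler_wpM2l => //.
  have xkM : 0 < x ^+ (k * M) by rewrite exprn_gt0 //; lra.
  have -> : x ^+ n / x ^+ (k * M) = x ^+ (n - k * M).
    by rewrite -{1}(subnK kMn) exprD mulfK // gt_eqF.
  apply: ler_pM.
  - by rewrite !mulr_ge0 ?exprn_ge0 //; lra.
  - by rewrite exprn_ge0 //; lra.
  - rewrite (exprS s 3) mulrA; apply: ler_wpM2r; first by rewrite exprn_ge0 //; lra.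
    by rewrite -mulrA; apply: ler_wpM2l => //; lra.
  - by apply: lerXn2r => //; rewrite nnegrE; lra.
have b0 : 0 <= b ^+ (n - k * M) by rewrite exprn_ge0 //; lra.
set e := 8 * 137 * s ^+ 4 * b ^+ (n - k * M) in A *.
have e0 : 0 <= e by rewrite /e !mulr_ge0 ?exprn_ge0 //; lra.
have I1 := integral_leZ (mulr_ge0 C0 e0) integral_cauchy_density.
have I2 : integral_le a b ('D_1 V) 0.
  exists V, ('D_1 V); split => //.
    by move=> x /A[D [hD _]]; rewrite (has_derive_val hD).
  by rewrite /V /w !subrr mulr0 !mul0r !mulr0 !mul0r !mulr0 !mul0r subrr.
apply: (integral_le_trans (integral_leD I2 I1)); last by rewrite add0r.
move=> x xab; have [D [hD]] := A x xab; rewrite (has_derive_val hD).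
rewrite ler_norml => /andP[h _]; rewrite -/(w x) (mulrC (w x)).
have -> : C * e * (1 + q.[x ^+ k] ^+ 2)^-1 = c x * e by rewrite /c; ring.
lra.
Qed.

End kernel.
End one_polynomial.
End pair_bound.

(** * Autocorrelation of a step function with integral zero *)

Section signed_square.
Context {R : realType}.

(** At the origin the difference quotient is [|u|], which is continuous and vanishes there. *)
Lemma has_derive_signed_square (x : R) :
  is_derive x 1 (fun u : R => u * `|u|) (2 * `|x|).
Proof.
have sq (e : R) : is_derive x 1 (fun u : R => e * (u * u)) (e * (2 * x)).
  have := has_deriveM (has_derive_cst e x) (has_deriveM (has_derive_id x) (has_derive_id x)).
  by rewrite mul0r add0r mul1r mulr1 -mulr2n -[in X in X -> _]mulr_natl.
have [x0|x0|->] := ltgtP x 0.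
- have := sq (-1); rewrite ltr0_norm // mulN1r -mulrN.
  apply: near_eq_is_derive.
  near=> y; rewrite ltr0_norm; first by rewrite mulN1r mulrN.
  near: y; exact: lt_nbhsl.
- have := sq 1; rewrite gtr0_norm // mul1r.
  apply: near_eq_is_derive.
  near=> y; rewrite gtr0_norm ?mul1r //.
  near: y; exact: lt_nbhsr.
- rewrite normr0 mulr0; apply/is_derive1_caratheodory.
  exists (fun u : R => `|u|); split.
  + by move=> u; rewrite mul0r !subr0 mulrC.
  + exact: norm_continuous.
  + exact: normr0.
Unshelve. all: by end_near.
Qed.

End signed_square.

Section kernel.
Context {R : realType} (I : finType).
Variables (al c : I -> R -> R).

(** The autocorrelation at [t] of the step function with jumps [al i x] at the places [c i x]. The
    formula holds when the jumps add up to 0. *)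
Definition jump_kernel (x t : R) : R :=
  - 2^-1 * \sum_i \sum_j al i x * al j x * `|t + (c i x - c j x)|.

Let psi (u : R) := u * `|u|.

(** A primitive of [jump_kernel x] in [t], because [u |u|] has derivative [2 |u|]. *)
Definition jump_primitive (x t : R) : R :=
  - 4^-1 * \sum_i \sum_j al i x * al j x * psi (t + (c i x - c j x)).

Variables (al' c' : I -> R -> R).

(** The derivative of [jump_primitive] in [x] at fixed [t], where [al'] and [c'] are the
    derivatives of [al] and [c]. *)
Definition jump_drift (x t : R) : R :=
  - 4^-1 * \sum_i \sum_j ((al' i x * al j x + al i x * al' j x) * psi (t + (c i x - c j x))
     + al i x * al j x * (2 * `|t + (c i x - c j x)| * (c' i x - c' j x))).

Lemma jump_kernel_even x t : jump_kernel x (- t) = jump_kernel x t.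
Proof.
rewrite /jump_kernel exchange_big /=; congr (_ * _).
apply: eq_bigr => i _; apply: eq_bigr => j _.
by rewrite (mulrC (al j x)) -normrN opprD opprK opprB.
Qed.

Lemma has_derive_sum (J : Type) (r : seq J) (f : J -> R -> R) (d : J -> R) (x : R) :
  (forall j, is_derive x 1 (f j) (d j)) ->
  is_derive x 1 (fun y => \sum_(j <- r) f j y) (\sum_(j <- r) d j).
Proof.
move=> h; elim: r => [|j r IH].
  rewrite big_nil (_ : (fun _ => _) = fun=> 0); first exact: has_derive_cst.
  by apply/funext => y; rewrite big_nil.
rewrite big_cons (_ : (fun _ => _) = fun y => f j y + \sum_(j <- r) f j y).
  exact: has_deriveD.
by apply/funext => y; rewrite big_cons.
Qed.

Lemma jump_primitive_derive (x : R) (Q : R -> R) dQ :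
  (forall i, is_derive x 1 (al i) (al' i x)) ->
  (forall i, is_derive x 1 (c i) (c' i x)) ->
  is_derive x 1 Q dQ ->
  is_derive x 1 (fun y => jump_primitive y (Q y))
    (jump_kernel x (Q x) * dQ + jump_drift x (Q x)).
Proof.
move=> dal dc dQx.
have -> : jump_kernel x (Q x) * dQ + jump_drift x (Q x) =
  0 * (\sum_i \sum_j al i x * al j x * psi (Q x + (c i x - c j x))) +
  - 4^-1 * \sum_i \sum_j ((al' i x * al j x + al i x * al' j x) * psi (Q x + (c i x - c j x)) +
     al i x * al j x * (2 * `|Q x + (c i x - c j x)| * (dQ + (c' i x + - c' j x)))).
  rewrite mul0r add0r /jump_kernel /jump_drift.
  have -> : - 2^-1 = - 4^-1 * 2 :> R by lra.
  rewrite -!mulrA -mulrDr; congr (_ * _).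
  rewrite mulrA mulrC !mulr_sumr -big_split; apply: eq_bigr => i _ /=.
  rewrite !mulr_sumr -big_split; apply: eq_bigr => j _ /=; ring.
rewrite /jump_primitive.
apply: (has_deriveM (has_derive_cst _ x)).
apply: has_derive_sum => i; apply: has_derive_sum => j.
apply: (has_deriveM (has_deriveM (dal i) (dal j))).
apply: (@has_derive_comp _ (fun y => Q y + (c i y - c j y)) psi).
  exact: has_derive_signed_square.
Qed.

Section vanishing.
Variables (x A : R).
Hypotheses (al0 : \sum_i al i x = 0) (al'0 : \sum_i al' i x = 0)
  (alc0 : \sum_i al i x * c i x = 0).

Let bilin1 (f g : I -> R) (t : R) : \sum_i g i = 0 -> \sum_i g i * c i x = 0 ->
  \sum_i \sum_j f i * g j * (t + (c i x - c j x)) = 0.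
Proof.
move=> g0 g1; apply: big1 => i _.
rewrite (eq_bigr (fun j => f i * (t + c i x) * g j - f i * (g j * c j x))).
  by rewrite sumrB -!mulr_sumr g0 g1; ring.
by move=> j _; ring.
Qed.

Let bilin1' (f g : I -> R) (t : R) : \sum_i g i = 0 -> \sum_i g i * c i x = 0 ->
  \sum_i \sum_j g i * f j * (t + (c i x - c j x)) = 0.
Proof.
move=> g0 g1; rewrite exchange_big; apply: big1 => i _ /=.
rewrite (eq_bigr (fun j => f i * (t - c i x) * g j + f i * (g j * c j x))).
  by rewrite big_split /= -!mulr_sumr g0 g1; ring.
by move=> j _; ring.
Qed.

(* The expansion has no other terms than products of a moment of [f] and a moment of [g]. *)
Let bilin2 (f g : I -> R) (t : R) : \sum_i f i = 0 -> \sum_i g i = 0 ->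
   \sum_i f i * c i x = 0 \/ \sum_i g i * c i x = 0 ->
  \sum_i \sum_j f i * g j * (t + (c i x - c j x)) ^+ 2 = 0.
Proof.
move=> f0 g0 fg.
have -> : \sum_i \sum_j f i * g j * (t + (c i x - c j x)) ^+ 2 =
  (\sum_i f i * (t + c i x) ^+ 2) * (\sum_i g i)
  - 2 * (\sum_i f i * (t + c i x)) * (\sum_i g i * c i x)
  + (\sum_i f i) * (\sum_i g i * c i x ^+ 2).
  transitivity (\sum_i (f i * (t + c i x) ^+ 2 * (\sum_j g j)
      - 2 * (f i * (t + c i x)) * (\sum_j g j * c j x)
      + f i * (\sum_j g j * c j x ^+ 2))).
    apply: eq_bigr => i _; rewrite !mulr_sumr -sumrB -big_split.
    by apply: eq_bigr => j _ /=; ring.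
  by rewrite big_split sumrB /= -!mulr_suml -mulr_sumr.
have -> : \sum_i f i * (t + c i x) = t * \sum_i f i + \sum_i f i * c i x.
  by rewrite mulr_sumr -big_split; apply: eq_bigr => i _ /=; ring.
by rewrite f0 g0; case: fg => ->; ring.
Qed.

Hypotheses (cA : forall i, 0 <= c i x <= A).

(* All places lie in [[0, A]], so beyond [A] every [t + (c i - c j)] has the sign of [t]. The
   absolute values disappear, and the kernels become polynomials in the moments of the jumps. *)
Let far t : A < `|t| -> exists e : R, forall i j,
  `|t + (c i x - c j x)| = e * (t + (c i x - c j x)).
Proof.
have [t0|t0] := leP 0 t; [rewrite ger0_norm // => tA|rewrite ltr0_norm // => tA].
  exists 1 => i j; rewrite mul1r ger0_norm //.
  by have /andP[? ?] := cA i; have /andP[? ?] := cA j; lra.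
exists (-1) => i j; rewrite mulN1r ler0_norm //.
by have /andP[? ?] := cA i; have /andP[? ?] := cA j; lra.
Qed.

Lemma jump_kernel_far t : A < `|t| -> jump_kernel x t = 0.
Proof.
move=> /far[e he]; rewrite /jump_kernel.
under eq_bigr => i _.
  under eq_bigr => j _ do rewrite he mulrCA.
  rewrite -mulr_sumr; over.
by rewrite -mulr_sumr bilin1 // !mulr0.
Qed.

(** Here the first moment of the jumps enters: it is minus the integral of the step function, and
    the primitive has compact support only if the kernel has integral zero. *)
Lemma jump_primitive_far t : A < `|t| -> jump_primitive x t = 0.
Proof.
move=> /far[e he]; rewrite /jump_primitive.
under eq_bigr => i _.
  under eq_bigr => j _ do rewrite /psi he (mulrCA _ e) -expr2 mulrCA.
  rewrite -mulr_sumr; over.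
by rewrite -mulr_sumr bilin2 ?mulr0 //; left.
Qed.

(** Beyond [A] the primitive vanishes for every [x], hence so does its derivative in [x]. *)
Lemma jump_drift_far t : A < `|t| -> jump_drift x t = 0.
Proof.
move=> /far[e he]; rewrite /jump_drift.
rewrite (_ : \sum_i _ = e * (
    \sum_i \sum_j al' i x * al j x * (t + (c i x - c j x)) ^+ 2 +
    \sum_i \sum_j al i x * al' j x * (t + (c i x - c j x)) ^+ 2 +
    2 * (\sum_i \sum_j (al i x * c' i x) * al j x * (t + (c i x - c j x)) -
         \sum_i \sum_j al i x * (al j x * c' j x) * (t + (c i x - c j x))))).
  rewrite (bilin2 _ al'0 al0 (or_intror alc0)) (bilin2 _ al0 al'0 (or_introl alc0)).
  by rewrite (bilin1 _ _ al0 alc0) (bilin1' _ _ al0 alc0); ring.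
rewrite -sumrB mulr_sumr -!big_split mulr_sumr; apply: eq_bigr => i _ /=.
rewrite -sumrB mulr_sumr -!big_split mulr_sumr; apply: eq_bigr => j _ /=.
rewrite /psi he; ring.
Qed.

Hypotheses (alA : forall i, `|al i x| <= A) (al'A : forall i, `|al' i x| <= A)
  (c'A : forall i, `|c' i x| <= A).

Definition jump_constant : R := 30 * (#|I|%:R * #|I|%:R) * A ^+ 4 * (1 + A ^+ 2).

Let double_sum_bound (F : I -> I -> R) (K e : R) : `|e| <= 1 -> 0 <= K ->
  (forall i j, `|F i j| <= K) ->
  `|e * \sum_i \sum_j F i j| <= #|I|%:R * #|I|%:R * K.
Proof.
move=> e1 K0 h; rewrite normrM -[leRHS]mul1r; apply: ler_pM => //.
have sumK (f : I -> R) L : (forall i, `|f i| <= L) -> `|\sum_i f i| <= #|I|%:R * L.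
  move=> hf; apply: le_trans (ler_norm_sum _ _ _) _.
  apply: le_trans (ler_sum _ (fun i _ => hf i)) _.
  by rewrite sumr_const mulr_natl.
by rewrite -mulrA; apply: (sumK) => i; exact: sumK.
Qed.

Let near_bound t i j : `|t| <= A -> `|t + (c i x - c j x)| <= 3 * A.
Proof.
have /andP[? ?] := cA i; have /andP[? ?] := cA j.
rewrite !ler_norml => /andP[? ?]; apply/andP; split; lra.
Qed.

Let from_bound (v t : R) : 1 <= A -> (A < `|t| -> v = 0) ->
  (`|t| <= A -> `|v| <= 30 * (#|I|%:R * #|I|%:R) * A ^+ 4) ->
  `|v| <= jump_constant / (1 + t ^+ 2).
Proof.
move=> A1 v0 hv; have t0 : 0 < 1 + t ^+ 2 by rewrite ltr_pwDl // sqr_ge0.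
have [tA|tA] := leP `|t| A; last first.
  rewrite v0 // normr0 divr_ge0 ?(ltW t0) // /jump_constant !mulr_ge0 ?exprn_ge0 //; try lra.
  by rewrite addr_ge0 // sqr_ge0.
rewrite ler_pdivlMr // /jump_constant; apply: ler_pM => //; first exact: ltW.
  exact: hv.
by rewrite lerD2l -real_normK ?num_real //; apply: lerXn2r; rewrite ?nnegrE //; lra.
Qed.

Lemma jump_kernel_bound t : 1 <= A -> `|t| <= A -> `|jump_kernel x t| <= jump_constant.
Proof.
move=> A1 tA; have A0 : 0 <= A by lra.
apply: (@le_trans _ _ (#|I|%:R * #|I|%:R * (3 * A ^+ 3))).
  apply: double_sum_bound; first by rewrite normrN ger0_norm; lra.
    by rewrite mulr_ge0 // exprn_ge0.
  move=> i j; rewrite !normrM normr_id (_ : 3 * A ^+ 3 = A * A * (3 * A)); last ring.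
  by rewrite !ler_pM // ?mulr_ge0 // near_bound.
have A3 : 0 <= A ^+ 3 by rewrite exprn_ge0.
have A34 : A ^+ 3 <= A ^+ 4 by apply: ler_weXn2l.
rewrite /jump_constant [leRHS](_ : _ = #|I|%:R * #|I|%:R * (30 * A ^+ 4 * (1 + A ^+ 2))); last ring.
rewrite ler_wpM2l ?mulr_ge0 //.
have : 30 * A ^+ 4 * 1 <= 30 * A ^+ 4 * (1 + A ^+ 2).
  by rewrite ler_wpM2l ?lerDl ?sqr_ge0 // mulr_ge0 // exprn_ge0.
lra.
Qed.

(** All three functions are bounded and supported in [[- A, A]], where [1 + t^2 <= 1 + A^2]. *)
Lemma jump_bounds t : 1 <= A -> [/\
  `|jump_kernel x t * t| <= jump_constant / (1 + t ^+ 2),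
  `|jump_primitive x t| <= jump_constant / (1 + t ^+ 2) &
  `|jump_drift x t| <= jump_constant / (1 + t ^+ 2)].
Proof.
move=> A1; have A0 : 0 <= A by lra.
have n0 : 0 <= #|I|%:R * #|I|%:R :> R by rewrite mulr_ge0.
have half : `|- 2^-1| <= 1 :> R by rewrite normrN ger0_norm; lra.
have quarter : `|- 4^-1| <= 1 :> R by rewrite normrN ger0_norm; lra.
have npsi u : `|u| <= 3 * A -> `|psi u| <= 9 * A ^+ 2.
  move=> hu; rewrite /psi normrM normr_id.
  have -> : 9 * A ^+ 2 = (3 * A) * (3 * A) by ring.
  exact: ler_pM.
have A4 : 0 <= A ^+ 4 by rewrite exprn_ge0.
have A30 e : e <= 30 -> #|I|%:R * #|I|%:R * (e * A ^+ 4) <= 30 * (#|I|%:R * #|I|%:R) * A ^+ 4.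
  move=> e30; rewrite [leRHS](_ : _ = #|I|%:R * #|I|%:R * (30 * A ^+ 4)); last ring.
  by rewrite ler_wpM2l // ler_wpM2r.
split; apply: from_bound => //.
- by move=> tA; rewrite jump_kernel_far // mul0r.
- move=> tA; rewrite normrM.
  apply: (@le_trans _ _ (#|I|%:R * #|I|%:R * (3 * A ^+ 3) * A)).
    apply: ler_pM => //; apply: double_sum_bound => //.
      by rewrite mulr_ge0 // exprn_ge0.
    move=> i j; rewrite !normrM normr_id (_ : 3 * A ^+ 3 = A * A * (3 * A)); last ring.
    by rewrite !ler_pM // ?mulr_ge0 // near_bound.
  have -> : #|I|%:R * #|I|%:R * (3 * A ^+ 3) * A = #|I|%:R * #|I|%:R * (3 * A ^+ 4) by ring.
  by apply: A30; lra.
- exact: jump_primitive_far.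
- move=> tA; apply: le_trans (A30 9 _); last lra.
  apply: double_sum_bound => //; first by rewrite mulr_ge0.
  move=> i j; rewrite [leRHS](_ : _ = A * A * (9 * A ^+ 2)); last ring.
  rewrite normrM (normrM (al i x)).
  by rewrite !ler_pM // ?mulr_ge0 // npsi // near_bound.
- exact: jump_drift_far.
- move=> tA; apply: le_trans (A30 30 _); last lra.
  apply: double_sum_bound => //; first by rewrite mulr_ge0.
  move=> i j; rewrite [leRHS](_ : _ = (A * A + A * A) * (9 * A ^+ 2) + A * A * (2 * (3 * A) * (A + A))); last ring.
  apply: le_trans (ler_normD _ _) _; apply: lerD; rewrite normrM; apply: ler_pM => //.
  + by apply: le_trans (ler_normD _ _) _; rewrite !normrM; apply: lerD; apply: ler_pM.
  + by rewrite npsi // near_bound.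
  + by rewrite normrM ler_pM.
  + rewrite !normrM normr_id (ger0_norm (_ : 0 <= 2)) //; apply: ler_pM => //.
      by rewrite ler_pM // near_bound.
    by apply: le_trans (ler_normB _ _) _; apply: lerD.
Qed.

End vanishing.
End kernel.

(** * Positive definite kernels, subset sums and step functions *)

Section positive_definite.
Context {R : realFieldType}.
Implicit Types (f : R -> R) (s : seq (R * R)) (c : seq R).

Definition quad_form f s : R :=
  \sum_(u <- s) \sum_(v <- s) u.1 * v.1 * f (u.2 - v.2).

Definition pos_def f := forall s, 0 <= quad_form f s.

(** Replacing a family of points by its union with a translate, weighted by [e], replaces the
    kernel by the combination on the right. *)
Lemma pos_def_double (e d : R) f : e ^+ 2 = 1 -> pos_def f ->
  pos_def (fun t => 2 * f t + e * (f (t + d) + f (t - d))).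
Proof.
move=> e2 pf s; have := pf (s ++ [seq (e * u.1, u.2 + d) | u <- s]).
rewrite /quad_form big_cat /= big_map -big_split /=; congr (_ <= _).
apply: eq_bigr => u _; rewrite !big_cat /= !big_map -!big_split /=.
apply: eq_bigr => v _.
have -> : u.2 - (v.2 + d) = u.2 - v.2 - d by ring.
have -> : u.2 + d - v.2 = u.2 - v.2 + d by ring.
have -> : u.2 + d - (v.2 + d) = u.2 - v.2 by ring.
have -> : e * u.1 * (e * v.1) = u.1 * v.1 by rewrite mulrACA -expr2 e2 mul1r.
ring.
Qed.

Lemma diff_sumD c f g :
  diff_sum c (fun t => f t + g t) = diff_sum c f + diff_sum c g.
Proof. by elim: c f g => //= d c IH f g; rewrite !IH; ring. Qed.

Lemma diff_sumZ c (e : R) f : diff_sum c (fun t => e * f t) = e * diff_sum c f.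
Proof. by elim: c f => //= d c IH f; rewrite !IH; ring. Qed.

Lemma diff_sum_cons d c f : diff_sum (d :: c) f =
  diff_sum c (fun t => 2 * f t + 1 * (f (t + d) + f (t - d))).
Proof. by rewrite /= diff_sumD !diff_sumZ diff_sumD mul1r addrA. Qed.

Lemma diff_sum_ge0 c f : pos_def f -> 0 <= diff_sum c f.
Proof.
elim: c f => [f pf|d c IH f pf].
  have := pf [:: (1, 0)].
  by rewrite /quad_form !big_seq1 /= !mul1r subr0.
by rewrite diff_sum_cons; apply/IH/pos_def_double => //; rewrite expr1n.
Qed.

(** The parallelogram law: a function plus its translate has norm at most twice its norm. It is
    the nonnegativity of the form that belongs to [e = -1]. *)
Lemma diff_sum_drop d c f : pos_def f -> diff_sum (d :: c) f <= 4 * diff_sum c f.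
Proof.
move=> pf; have e1 : (-1) ^+ 2 = 1 :> R by rewrite sqrrN expr1n.
have := diff_sum_ge0 c (pos_def_double d e1 pf).
by rewrite /= diff_sumD !diff_sumZ diff_sumD; lra.
Qed.

(** The kernel [f] varies in the induction because keeping the head [d] replaces [f] by its
    doubled version. *)
Lemma diff_sum_subseq c c' f : subseq c' c -> pos_def f ->
  diff_sum c f <= 4 ^+ (size c - size c') * diff_sum c' f.
Proof.
elim: c c' f => [|d c IH] c' f.
  by rewrite subseq0 => /eqP -> _; rewrite expr0 mul1r.
move=> sub pf.
have skip : subseq c' c ->
    diff_sum (d :: c) f <= 4 ^+ (size (d :: c) - size c') * diff_sum c' f.
  move=> sub'; apply: le_trans (diff_sum_drop _ _ pf) _.
  rewrite /= subSn ?size_subseq // exprS -mulrA ler_wpM2l //; exact: IH.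
case: c' sub skip => [|d' c'] sub skip; first exact/skip/sub0seq.
rewrite /= in sub; move: sub; case: eqP => [->|_] sub; last exact: skip.
rewrite diff_sum_cons (diff_sum_cons d c') /= subSS.
by apply: IH => //; apply: pos_def_double => //; rewrite expr1n.
Qed.

Lemma size_powers (B : R) n : size (powers B n) = n.
Proof. by elim: n => //= n ->. Qed.

Lemma subseq_powers (B : R) k n N : (0 < k)%N ->
  (N == 0)%N || (k * N.-1 < n)%N -> subseq (powers (B ^+ k) N) (powers B n).
Proof.
move=> k0; elim: n N => [|n IH] [|N] //.
move=> /= kNn; case: eqP => [_|e]; last first.
  apply: (IH N.+1) => /=; move: kNn; rewrite ltnS leq_eqVlt => /orP[/eqP kN|//].
  by case: e; rewrite -exprM kN.
apply: IH; case: N kNn => //= N; rewrite ltnS; apply: leq_trans.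
by rewrite ltn_pmul2l.
Qed.

End positive_definite.

Section subset_sums.
Context {R : comPzRingType}.
Implicit Types (c : seq R) (f : R -> R).

(** The argument of [f] runs over the sums of all sub-multisets of [c]. *)
Fixpoint subset_sum c f : R :=
  if c is d :: c' then subset_sum c' f + subset_sum c' (fun p => f (p + d))
  else f 0.

Lemma eq_subset_sum c f g : f =1 g -> subset_sum c f = subset_sum c g.
Proof.
elim: c f g => [|d c IH] f g fg /=; first exact: fg.
by congr (_ + _); apply: IH => t; exact: fg.
Qed.

Lemma subset_sumD c f g :
  subset_sum c (fun t => f t + g t) = subset_sum c f + subset_sum c g.
Proof. by elim: c f g => //= d c IH f g; rewrite !IH addrACA. Qed.

Lemma subset_sumZ c (e : R) f : subset_sum c (fun t => e * f t) = e * subset_sum c f.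
Proof. by elim: c f => //= d c IH f; rewrite !IH mulrDr. Qed.

Lemma subset_sum_diff c f :
  subset_sum c (fun p => subset_sum c (fun p' => f (p - p'))) = diff_sum c f.
Proof.
elim: c f => [|d c IH] f /=; first by rewrite subr0.
rewrite !subset_sumD IH.
rewrite -(IH (fun t => f (t + d))) -(IH (fun t => f (t - d))).
have -> : subset_sum c (fun p => subset_sum c (fun p' => f (p - (p' + d)))) =
          subset_sum c (fun p => subset_sum c (fun p' => f (p - p' - d))).
  by do 2 apply: eq_subset_sum => ?; rewrite opprD addrA.
have -> : subset_sum c (fun p => subset_sum c (fun p' => f (p + d - p'))) =
          subset_sum c (fun p => subset_sum c (fun p' => f (p - p' + d))).
  by do 2 apply: eq_subset_sum => ?; rewrite addrAC.
have -> : subset_sum c (fun p => subset_sum c (fun p' => f (p + d - (p' + d)))) =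
          diff_sum c f.
  rewrite -IH; do 2 apply: eq_subset_sum => ?.
  by rewrite opprD addrACA subrr addr0.
ring.
Qed.

End subset_sums.

Section integrates.
Context {R : realType}.
Local Notation mu := (@lebesgue_measure R).
Implicit Types (f g : R -> R) (u v : R).

Definition integrates f v :=
  mu.-integrable setT (EFin \o f) /\ (\int[mu]_x (f x)%:E)%E = v%:E.

Lemma eq_integrates f g v : f =1 g -> integrates f v -> integrates g v.
Proof. by move=> /funext ->. Qed.

Lemma integratesD f g u v : integrates f u -> integrates g v ->
  integrates (fun x => f x + g x) (u + v).
Proof.
move=> [fi fu] [gi gv]; split.
  by have := integrableD measurableT fi gi; apply: eq_integrable.
by rewrite (integralD_EFin measurableT fi gi) fu gv.
Qed.

Lemma integratesZ (e : R) f v : integrates f v ->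
  integrates (fun x => e * f x) (e * v).
Proof.
move=> [fi fv]; split.
  by have := integrableZl measurableT e fi; apply: eq_integrable.
under eq_integral do rewrite EFinM.
by rewrite (integralZl measurableT fi) fv.
Qed.

Lemma integrates0 : integrates (fun=> 0) 0.
Proof. by split; [exact: integrable0|rewrite integral0]. Qed.

Lemma integrates_sum (I : Type) (r : seq I) (F : I -> R -> R) (V : I -> R) :
  (forall i, integrates (F i) (V i)) ->
  integrates (fun x => \sum_(i <- r) F i x) (\sum_(i <- r) V i).
Proof.
move=> h; elim: r => [|i r IH].
  rewrite big_nil; apply: (eq_integrates _ integrates0) => x.
  by rewrite big_nil.
rewrite big_cons; apply: (eq_integrates _ (integratesD (h i) IH)) => x.
by rewrite big_cons.
Qed.

Lemma integrates_subset_sum c (F : R -> R -> R) (V : R -> R) :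
  (forall p, integrates (F p) (V p)) ->
  integrates (fun x => subset_sum c (fun p => F p x)) (subset_sum c V).
Proof.
elim: c F V => [|d c IH] F V h //=; apply: integratesD; first exact: IH.
by apply: (IH (fun p => F (p + d))).
Qed.

Lemma integrates_ge0 f v : (forall x, 0 <= f x) -> integrates f v -> 0 <= v.
Proof.
move=> f0 [_ fv]; rewrite -lee_fin -fv; apply: integral_ge0 => x _.
by rewrite lee_fin.
Qed.

Lemma integrates_itv (p T : R) : p <= T ->
  integrates (fun x => (p <= x)%R%:R - (T <= x)%R%:R) (T - p).
Proof.
move=> pT.
have E x : (p <= x)%R%:R - (T <= x)%R%:R = \1_(`[p, T[) x :> R.
  rewrite indicE; have [xT|xT] := leP T x.
    rewrite (le_trans pT xT) subrr memNset //= in_itv /= => /andP[_].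
    by rewrite ltNge xT.
  rewrite subr0; congr ((nat_of_bool _)%:R); apply/idP/idP.
    by move=> px; rewrite inE /= in_itv /= px xT.
  by rewrite inE /= in_itv /= => /andP[].
apply: (eq_integrates (fun x => esym (E x))); split.
  exact: integrable_indic_itv.
rewrite integral_indic //= setIT lebesgue_measure_itv /= lte_fin.
have [pT'|Tp|->] := ltgtP p T => //; last by rewrite subrr.
by move: pT; rewrite leNgt Tp.
Qed.

(** Since both families of jumps add up to 0, one may cut every step off at a common large [T].
    The product of two cut steps is the indicator of [[max p r, T)], of length [T - max p r], and
    [max p r = (p + r + |p - r|) / 2]. Only [|p - r|] survives the summation. *)
Lemma integrates_step_product (I J : finType) (a p : I -> R) (b r : J -> R) :
  \sum_i a i = 0 -> \sum_j b j = 0 ->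
  integrates (fun x => (\sum_i a i * (p i <= x)%R%:R) * (\sum_j b j * (r j <= x)%R%:R))
   (- 2^-1 * \sum_i \sum_j a i * b j * `|p i - r j|).
Proof.
move=> a0 b0.
have ab (F : I -> R) (G : J -> R) : \sum_i \sum_j a i * b j * (F i + G j) = 0.
  rewrite (eq_bigr (fun i => a i * F i * (\sum_j b j) + a i * (\sum_j b j * G j))).
    by rewrite big_split /= -!mulr_suml a0 b0; ring.
  move=> i _; rewrite !mulr_sumr -big_split; apply: eq_bigr => j _ /=; ring.
pose T := \sum_i `|p i| + \sum_j `|r j|.
have Tp i : p i <= T.
  apply: le_trans (ler_norm _) _; rewrite /T (bigD1 i) //= -addrA lerDl.
  by rewrite addr_ge0 ?sumr_ge0.
have Tr j : r j <= T.
  apply: le_trans (ler_norm _) _; rewrite /T (bigD1 j) //= addrCA lerDl.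
  by rewrite addr_ge0 ?sumr_ge0.
have h : integrates (fun x => \sum_i \sum_j a i * b j *
    ((Num.max (p i) (r j) <= x)%R%:R - (T <= x)%R%:R))
    (\sum_i \sum_j a i * b j * (T - Num.max (p i) (r j))).
  apply: integrates_sum => i; apply: integrates_sum => j; apply: integratesZ.
  by apply: integrates_itv; rewrite ge_max Tp Tr.
have -> : - 2^-1 * \sum_i \sum_j a i * b j * `|p i - r j| =
    \sum_i \sum_j a i * b j * (T - Num.max (p i) (r j)).
  rewrite -[RHS]subr0 -[X in _ = _ - X](ab (fun i => T - p i / 2) (fun j => - r j / 2)).
  rewrite mulr_sumr -sumrB; apply: eq_bigr => i _.
  rewrite mulr_sumr -sumrB; apply: eq_bigr => j _; rewrite maxr_absE; field=> //.
apply: (eq_integrates _ h) => x.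
rewrite -[RHS]addr0 -[X in _ = _ + X](ab (fun=> - (T <= x)%R%:R) (fun=> 0)).
rewrite mulr_suml -big_split; apply: eq_bigr => i _ /=.
rewrite mulr_sumr -big_split; apply: eq_bigr => j _ /=.
by rewrite ge_max -mulnb natrM; ring.
Qed.

End integrates.

(** * The normalised counts and their increments *)

Section counting.
Context {R : realType}.
Implicit Types (b x y : R) (n : nat).

(** The function [P 1_[0, L) - 1_[0, L)], for [L = 1 / (b - 1)], jumps by [jump_weight i b] at
    [jump_place i b]. The places come from [0 <= b y < L] and [0 <= b y - 1 < L], where
    [L + 1 = b L]. *)
Definition jump_weight (i : 'I_4) b : R :=
  [:: b / 2 - 1; b / 2; - (b / 2); 1 - b / 2]`_i.

Definition jump_place (i : 'I_4) b : R :=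
  [:: 0; b^-1; (b * (b - 1))^-1; (b - 1)^-1]`_i.

(** The indicator of [[0, L)]. Half-open intervals make [half_open_refine] an identity that holds
    everywhere. *)
Definition half_open b y : R := (0 <= y)%R%:R - ((b - 1)^-1 <= y)%R%:R.

Definition jump_profile b y : R :=
  \sum_i jump_weight i b * (jump_place i b <= y)%R%:R.

Definition smoothed_count b n x : R :=
  (b / 2) ^+ n * subset_sum (powers b n) (fun p => half_open b (b ^+ n * x - p)).

Lemma jump_weight_sum b : \sum_i jump_weight i b = 0.
Proof. by rewrite !big_ord_recl big_ord0 /jump_weight /=; ring. Qed.

Lemma jump_weight_place b : 1 < b -> \sum_i jump_weight i b * jump_place i b = 0.
Proof.
move=> b1; rewrite !big_ord_recl big_ord0 /jump_weight /jump_place /=.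
have b0 : b != 0 by rewrite gt_eqF //; lra.
have b10 : b - 1 != 0 by rewrite gt_eqF //; lra.
by field; rewrite b0 b10.
Qed.

(** Here the last digit is split off, as opposed to the first one in the definition. *)
Lemma subset_sum_powersS b n (f : R -> R) :
  subset_sum (powers b n.+1) f =
  subset_sum (powers b n) (fun p => f (b * p) + f (b * p + 1)).
Proof.
elim: n f => [|n IH] f; first by rewrite /= mulr0 expr0.
have -> : subset_sum (powers b n.+2) f = subset_sum (powers b n.+1) f +
   subset_sum (powers b n.+1) (fun p => f (p + b ^+ n.+1)) by [].
rewrite (IH f) (IH (fun p => f (p + b ^+ n.+1))) /=; congr (_ + _).
apply: eq_subset_sum => p.
by rewrite mulrDr -exprS addrAC.
Qed.

Lemma half_open_refine b y : 1 < b ->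
  b / 2 * (half_open b (b * y) + half_open b (b * y - 1)) - half_open b y =
  jump_profile b y.
Proof.
move=> b1; have b0 : 0 < b by lra.
have b10 : 0 < b - 1 by lra.
rewrite /half_open /jump_profile !big_ord_recl big_ord0 /jump_weight /jump_place /=.
rewrite pmulr_rge0 // subr_ge0.
have -> : (1 <= b * y) = (b^-1 <= y) by rewrite -ler_pdivrMl // mulr1.
have -> : ((b - 1)^-1 <= b * y) = ((b * (b - 1))^-1 <= y).
  by rewrite -ler_pdivrMl // invfM.
have -> : ((b - 1)^-1 <= b * y - 1) = ((b - 1)^-1 <= y).
  rewrite lerBrDr (_ : (b - 1)^-1 + 1 = b * (b - 1)^-1); first by rewrite ler_pM2l.
  by field; rewrite gt_eqF.
ring.
Qed.

Lemma smoothed_count_increment b n x : 1 < b ->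
  smoothed_count b n.+1 x - smoothed_count b n x =
  (b / 2) ^+ n * subset_sum (powers b n) (fun p => jump_profile b (b ^+ n * x - p)).
Proof.
move=> b1; rewrite /smoothed_count subset_sum_powersS exprSr -mulrA -mulrBr.
congr (_ * _); rewrite -subset_sumZ.
rewrite -[X in _ - X]mul1r -mulNr -subset_sumZ -subset_sumD.
apply: eq_subset_sum => p; rewrite -half_open_refine //.
rewrite exprS mulN1r; congr (_ * (half_open b _ + half_open b _) - _); ring.
Qed.

Lemma jump_profile_product b (K p p' : R) : 1 < b -> 0 < K ->
  integrates (fun x => jump_profile b (K * x - p) * jump_profile b (K * x - p'))
    (K^-1 * jump_kernel jump_weight jump_place b (p - p')).
Proof.
move=> b1 K0.
have := integrates_step_product (a := fun i => jump_weight i b)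
  (b := fun i => jump_weight i b) (fun i => K^-1 * (p + jump_place i b))
  (fun i => K^-1 * (p' + jump_place i b)) (jump_weight_sum b) (jump_weight_sum b).
have -> : K^-1 * jump_kernel jump_weight jump_place b (p - p') =
  - 2^-1 * (\sum_i \sum_j jump_weight i b * jump_weight j b *
    `|K^-1 * (p + jump_place i b) - K^-1 * (p' + jump_place j b)|).
  rewrite /jump_kernel mulrCA; congr (_ * _); rewrite mulr_sumr; apply: eq_bigr => i _.
  rewrite mulr_sumr; apply: eq_bigr => j _.
  rewrite -mulrBr normrM (gtr0_norm (_ : 0 < K^-1)) ?invr_gt0 // mulrCA.
  by do 2 congr (_ * _); congr (`| _ |); ring.
apply: eq_integrates => x; rewrite /= /jump_profile; congr (_ * _);
  apply: eq_bigr => i _; congr (_ * (nat_of_bool _)%:R);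
  by rewrite ler_pdivrMl // lerBrDl.
Qed.

Lemma jump_kernel_pos_def b : 1 < b ->
  pos_def (jump_kernel jump_weight jump_place b).
Proof.
move=> b1 s; set G := jump_kernel _ _ _.
have h : integrates
    (fun x => \sum_(u <- s) \sum_(v <- s) u.1 * v.1 *
      (jump_profile b (1 * x - u.2) * jump_profile b (1 * x - v.2)))
    (\sum_(u <- s) \sum_(v <- s) u.1 * v.1 * (1^-1 * G (u.2 - v.2))).
  apply: integrates_sum => u; apply: integrates_sum => v; apply: integratesZ.
  exact: jump_profile_product.
have -> : quad_form G s = \sum_(u <- s) \sum_(v <- s) u.1 * v.1 * (1^-1 * G (u.2 - v.2)).
  by rewrite /quad_form; do 2 (apply: eq_bigr => ? _); rewrite invr1 mul1r.
apply: integrates_ge0 h => x.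
rewrite (_ : \sum_(u <- s) _ = (\sum_(u <- s) u.1 * jump_profile b (1 * x - u.2)) ^+ 2).
  exact: sqr_ge0.
rewrite expr2 mulr_suml; apply: eq_bigr => u _; rewrite mulr_sumr.
by apply: eq_bigr => v _; rewrite mulrACA.
Qed.

(** The square of the increment is expanded over pairs of words, and each product of two
    translates of the profile integrates to the kernel at the difference of the translations. *)
Lemma increment_norm b n : 1 < b ->
  integrates (fun x => (smoothed_count b n.+1 x - smoothed_count b n x) ^+ 2)
    ((b / 4) ^+ n * diff_sum (powers b n) (jump_kernel jump_weight jump_place b)).
Proof.
move=> b1; set G := jump_kernel _ _ _; set K := b ^+ n.
have b0 : 0 < b by lra.
have K0 : 0 < K by rewrite exprn_gt0.
have := integratesZ (((b / 2) ^+ n) ^+ 2)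
  (integrates_subset_sum (powers b n) (fun p =>
    integrates_subset_sum (powers b n) (fun p' => jump_profile_product p p' b1 K0))).
have -> : (b / 4) ^+ n * diff_sum (powers b n) G = ((b / 2) ^+ n) ^+ 2 *
   subset_sum (powers b n) (fun p => subset_sum (powers b n) (fun p' => K^-1 * G (p - p'))).
  rewrite -subset_sum_diff.
  under [in RHS]eq_subset_sum => p do rewrite subset_sumZ.
  rewrite subset_sumZ mulrA; congr (_ * _).
  rewrite /K -exprAC -exprVn -exprMn; congr (_ ^+ _); field; lra.
apply: eq_integrates => x; rewrite smoothed_count_increment // [RHS](exprMn 2); congr (_ * _).
rewrite expr2 -[RHS]subset_sumZ; apply: eq_subset_sum => p.
by rewrite subset_sumZ mulrC.
Qed.

Lemma sum_tuple_cons n (F : seq bool -> R) :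
  \sum_(w : n.+1.-tuple bool) F w =
  \sum_(w : n.-tuple bool) F (false :: w) + \sum_(w : n.-tuple bool) F (true :: w).
Proof.
rewrite (reindex (fun p : bool * n.-tuple bool => [tuple of p.1 :: p.2])) /=; last first.
  exists (fun w : n.+1.-tuple bool => (thead w, [tuple of behead w])).
    by move=> [a w] _; congr (_, _); exact: val_inj.
  by move=> w _; rewrite [RHS]tuple_eta.
rewrite -(pair_big xpredT xpredT (fun a (w : n.-tuple bool) => F (a :: w))) /=.
by rewrite big_bool /= addrC.
Qed.

(** Applying the digits of [w] to [x] gives [b^n x - p], where [p] is the subset sum of
    [powers b n] selected by [w]. *)
Lemma sum_words b n x (F : R -> R) :
  \sum_(w : n.-tuple bool) F (Tword b w x) =
  subset_sum (powers b n) (fun p => F (b ^+ n * x - p)).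
Proof.
elim: n x => [|n IH] x.
  rewrite (big_pred1 [tuple]) /=; first by rewrite /Tword /= expr0 mul1r subr0.
  by move=> w; rewrite (tuple0 w) /= eqxx.
rewrite (sum_tuple_cons n (fun w => F (Tword b w x))) /=.
have E a : \sum_(w : n.-tuple bool) F (Tword b (a :: w) x) =
    subset_sum (powers b n) (fun p => F (b ^+ n * (b * x - a%:R) - p)).
  exact: (IH (b * x - a%:R)).
rewrite !E /=; congr (_ + _); apply: eq_subset_sum => p; rewrite exprSr; congr (F _); ring.
Qed.

Lemma size_Obeta b n x :
  (size (Obeta b n x))%:R = \sum_(w : n.-tuple bool) (Tword b w x \in Ibeta b)%:R :> R.
Proof.
rewrite /Obeta size_filter -sum1_count big_map /= big_enum_cond.
rewrite natr_sum big_mkcond /=; apply: eq_bigr => w _.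
by case: ifP.
Qed.

(** Closed and half-open intervals differ only at the right endpoint. *)
Lemma size_Obeta_smoothed b n x : 1 < b ->
  (forall w : seq bool, Tword b w x != (b - 1)^-1) ->
  (b / 2) ^+ n * (size (Obeta b n x))%:R = smoothed_count b n x.
Proof.
move=> b1 hx; rewrite /smoothed_count -(sum_words _ _ _ (half_open b)) size_Obeta.
congr (_ * _); apply: eq_bigr => w _; rewrite /Ibeta in_itv /= /half_open.
have := hx w; set y := Tword _ _ _; rewrite neq_lt => /orP[h|h].
  by rewrite (ltW h) andbT (leNgt (b - 1)^-1) h subr0.
have L0 : 0 < (b - 1)^-1 by rewrite invr_gt0; lra.
by rewrite (leNgt y) h andbF (ltW h) (ltW (lt_trans L0 h)) subrr.
Qed.

End counting.

(** * The step function of the problem and elementary estimates *)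

Section instance.
Context {R : realType}.
Variables (a b : R).

Definition jump_weight' (i : 'I_4) (x : R) : R :=
  [:: 2^-1; 2^-1; - 2^-1; - 2^-1]`_i.

Definition jump_place' (i : 'I_4) (x : R) : R :=
  [:: 0; - (1 / x ^+ 2); - ((2 * x - 1) / (x * (x - 1)) ^+ 2);
      - (1 / (x - 1) ^+ 2)]`_i.

Lemma jump_weight_derive i (x : R) :
  is_derive x 1 (jump_weight i) (jump_weight' i x).
Proof.
have lin (c d : R) : is_derive x 1 (fun y : R => c * y + d) c.
  have := has_deriveD (has_deriveM (has_derive_cst c x) (has_derive_id x)) (has_derive_cst d x).
  by rewrite mul0r add0r mulr1 addr0.
case: i => [[|[|[|[|//]]]] ?]; rewrite /jump_weight' /=.
- rewrite (_ : jump_weight _ = fun y : R => 2^-1 * y + -1) //.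
  by apply/funext => y; rewrite /jump_weight /=; ring.
- rewrite (_ : jump_weight _ = fun y : R => 2^-1 * y + 0) //.
  by apply/funext => y; rewrite /jump_weight /=; ring.
- rewrite (_ : jump_weight _ = fun y : R => - 2^-1 * y + 0) //.
  by apply/funext => y; rewrite /jump_weight /=; ring.
- rewrite (_ : jump_weight _ = fun y : R => - 2^-1 * y + 1) //.
  by apply/funext => y; rewrite /jump_weight /=; ring.
Qed.

Lemma jump_place_derive i (x : R) : 1 < x ->
  is_derive x 1 (jump_place i) (jump_place' i x).
Proof.
move=> x1; have x0 : x != 0 by rewrite gt_eqF //; lra.
have x10 : x - 1 != 0 by rewrite gt_eqF //; lra.
have d1 : is_derive x 1 (fun y : R => y - 1) (1 + 0).
  exact: has_deriveD (has_derive_id x) (has_derive_cst _ x).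
have d2 := has_deriveM (has_derive_id x) d1.
case: i => [[|[|[|[|//]]]] ?]; rewrite /jump_place' /=.
- exact: has_derive_cst.
- exact: (has_deriveV (has_derive_id x) x0).
- have := has_deriveV d2 (mulf_neq0 x0 x10).
  by rewrite (_ : 1 * (x - 1) + x * (1 + 0) = 2 * x - 1) //; ring.
- by have := has_deriveV d1 x10; rewrite addr0.
Qed.

(** A common bound for places, jumps and their derivatives: [L + L^2 <= (1 + L)^2]. *)
Definition jump_size : R := (1 + (a - 1)^-1) ^+ 2.

Hypotheses (a1 : 1 < a).

Let a1' : 1 < a. Proof. exact: a1. Qed.

Lemma jump_size_ge1 : 1 <= jump_size.
Proof.
have h := a1'.
have i0 : 0 <= (a - 1)^-1 by rewrite invr_ge0; lra.
by rewrite /jump_size exprn_ege1 // lerDl.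
Qed.

Lemma jump_instance_bounds i x : a <= x <= 2 ->
  [/\ 0 <= jump_place i x <= jump_size, `|jump_weight i x| <= jump_size,
      `|jump_weight' i x| <= jump_size & `|jump_place' i x| <= jump_size].
Proof.
have h := a1'; move=> /andP[ax xb].
have J1 := jump_size_ge1.
set L := (x - 1)^-1.
have L0 : 0 < L by rewrite invr_gt0; lra.
have LL : L <= (a - 1)^-1 by rewrite lef_pV2 ?posrE; lra.
have i0 : 0 < x^-1 by rewrite invr_gt0; lra.
have i1 : x^-1 <= 1 by rewrite invf_le1; lra.
have JL : L + L ^+ 2 <= jump_size.
  have : L ^+ 2 <= (a - 1)^-1 ^+ 2 by rewrite lerXn2r ?nnegrE; lra.
  rewrite /jump_size; move: ((a - 1)^-1) LL => l; nra.
have J2 : 0 <= L ^+ 2 by rewrite exprn_ge0 ?ltW.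
have i2 : 0 <= x^-1 ^+ 2 <= 1.
  by apply/andP; split; [apply: exprn_ge0|apply: exprn_ile1]; rewrite ?(ltW i0).
have xL : x^-1 * L <= L by rewrite -[leRHS]mul1r ler_wpM2r // ltW.
have xL0 : 0 <= x^-1 * L by rewrite mulr_ge0 ?ltW.
split.
- case: i => [[|[|[|[|//]]]] ?]; rewrite /jump_place /= ?invfM -/L; apply/andP; split; lra.
- case: i => [[|[|[|[|//]]]] ?]; rewrite /jump_weight /= ler_norml; apply/andP; split; lra.
- case: i => [[|[|[|[|//]]]] ?]; rewrite /jump_weight' /= ler_norml; apply/andP; split; lra.
- have /andP[i20 i21] := i2.
  case: i => [[|[|[|[|//]]]] ?]; rewrite /jump_place' /= ?normr0 ?normrN ?div1r.
  + lra.
  + by rewrite -exprVn ger0_norm //; lra.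
  + have -> : (2 * x - 1) / (x * (x - 1)) ^+ 2 = (x^-1 * L) * L + (x^-1 * L) * x^-1.
      by rewrite /L; field; rewrite !gt_eqF //; lra.
    rewrite ger0_norm; last by rewrite addr_ge0 // mulr_ge0 // ltW.
    apply: le_trans JL; rewrite addrC; apply: lerD.
      by rewrite -[leRHS]mulr1 ler_pM // ltW.
    by rewrite expr2 ler_pM // ltW.
  + by rewrite -exprVn -/L ger0_norm //; lra.
Qed.

End instance.

Section polynomial_geometric.
Context {R : realFieldType}.

(** Bernoulli's inequality bounds [n + 1] by a multiple of [t^n] for any [t > 1], and [t] is chosen
    so that the product with the previous ratio stays below 1. *)
Lemma poly_geometric (p : nat) (r : R) : 0 < r < 1 -> exists C r' : R,
  [/\ 0 < C, 0 < r' < 1 & forall n, n.+1%:R ^+ p * r ^+ n <= C * r' ^+ n].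
Proof.
move=> hr; elim: p => [|p [C [r' [C0 /andP[r0 r1] IH]]]].
  by exists 1, r; split => // n; rewrite expr0.
pose t := 1 + (1 - r') / 2.
have t1 : 0 < t - 1 by rewrite /t; lra.
exists (C / (t - 1)), (r' * t); split; first by rewrite divr_gt0.
  by rewrite /t; apply/andP; split; nra.
move=> n; have bern : n.+1%:R <= t ^+ n / (t - 1).
  elim: n => [|n IHn]; first by rewrite expr0 ler_pdivlMr // /t; lra.
  apply: (@le_trans _ _ (t ^+ n / (t - 1) + 1)); first by rewrite -natr1 lerD2r.
  rewrite exprS -mulrA -lerBrDl -[X in _ - X]mul1r -mulrBl mulrCA divff ?gt_eqF // mulr1.
  by apply: exprn_ege1; rewrite /t; lra.
rewrite exprSr -mulrA mulrCA mulrC exprMn.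
have -> : C / (t - 1) * (r' ^+ n * t ^+ n) = C * r' ^+ n * (t ^+ n / (t - 1)).
  by field; rewrite gt_eqF.
apply: ler_pM => //; rewrite mulr_ge0 ?exprn_ge0 //; lra.
Qed.

Lemma root_below (k : nat) (r : R) : (0 < k)%N -> 0 < r < 1 ->
  exists2 r' : R, 0 < r' < 1 & r <= r' ^+ k.
Proof.
move=> k0 /andP[r0 r1]; pose d := (1 - r) / k%:R.
have kR : 0 < (k%:R : R) by rewrite ltr0n.
have k1 : 1 <= (k%:R : R) by rewrite ler1n.
have d0 : 0 < d by rewrite divr_gt0 //; lra.
have d1 : d <= 1 - r by rewrite ler_pdivrMr // ler_peMr //; lra.
exists (1 - d); first by apply/andP; split; lra.
have bern n : 1 - n%:R * d <= (1 - d) ^+ n.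
  elim: n => [|n IH]; first by rewrite mul0r subr0 expr0.
  have hd : 0 <= 1 - d by lra.
  rewrite exprS -natr1; have := ler_wpM2l hd IH.
  have := mulr_ge0 (mulr_ge0 (ler0n R n) (ltW d0)) (ltW d0).
  lra.
by have := bern k; rewrite /d mulrC divfK ?gt_eqF //; lra.
Qed.

End polynomial_geometric.

(** * Averaging the energy over the base *)

Section integrated_energy.
Context {R : realType}.
Variables (a b : R) (k : nat).
Hypotheses (k_gt0 : (0 < k)%N) (a1 : 1 < a) (ab : a < b) (b_le : b <= 2)
  (ba1 : b - a <= 1) (ak : 25 / 16 <= a ^+ k) (bk : b ^+ k < 2).

Local Notation G := (jump_kernel jump_weight jump_place).

Let ab_range : [/\ 1 < a, a < b, b <= 2 & b - a <= 1]. Proof. by split. Qed.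

Definition energy_constant : R := jump_constant 'I_4 (jump_size a).

Let bounds x t : a <= x <= b -> [/\
  `|G x t * t| <= energy_constant / (1 + t ^+ 2),
  `|jump_primitive jump_weight jump_place x t| <= energy_constant / (1 + t ^+ 2),
  `|jump_drift jump_weight jump_place jump_weight' jump_place' x t|
     <= energy_constant / (1 + t ^+ 2) &
  `|G x 0| <= energy_constant].
Proof.
have [h1 h2 h3 h4] := ab_range; move=> /andP[ax xb].
have x1 : 1 < x by lra.
have xa2 : a <= x <= 2 by apply/andP; split; lra.
have J1 := jump_size_ge1 h1.
have s0 := jump_weight_sum x.
have s0' : \sum_i @jump_weight' R i x = 0.
  by rewrite !big_ord_recl big_ord0 /jump_weight' /=; lra.
have s1 := jump_weight_place x1.
have B i := jump_instance_bounds h1 i xa2.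
have B1 i : 0 <= jump_place i x <= jump_size a by case: (B i).
have B2 i : `|jump_weight i x| <= jump_size a by case: (B i).
have B3 i : `|jump_weight' i x| <= jump_size a by case: (B i).
have B4 i : `|jump_place' i x| <= jump_size a by case: (B i).
have [j1 j2 j3] := jump_bounds s0 s0' s1 B1 B2 B3 B4 t J1.
split => //; apply: (jump_kernel_bound B1 B2) => //.
by rewrite normr0; lra.
Qed.

(** The powers below [M] are moved one at a time from the list into the polynomial, and each of
    the four choices of a pair of digits yields a polynomial of the same kind. *)
Lemma diff_sum_integral_le (m M n : nat) (s : R) (q : {poly R}) :
  (m <= M)%N -> (size q <= M.+1)%N -> q`_M = 1 -> (forall i, `|q`_i| <= 1) ->
  (forall i, (i < m)%N -> q`_i = 0) -> M.+1%:R <= s -> (k * M <= n)%N ->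
  n.+1%:R <= s ->
  integral_le a b
    (fun x => x ^+ n * ((x - a) * (b - x)) *
       diff_sum (powers (x ^+ k) m) (fun t => G x (t + q.[x ^+ k])))
    (4 ^+ m * pair_constant a b k M s energy_constant n).
Proof.
have [h1 h2 h3 h4] := ab_range.
elim: m q => [|m IH] q mM sq qM q1 q0 sM kMn sn.
  rewrite expr0 mul1r.
  apply: (integral_le_trans (v := fun x => x ^+ n * ((x - a) * (b - x)) * G x q.[x ^+ k])
    (K := pair_constant a b k M s energy_constant n)) => //; last first.
    by move=> x _; rewrite /= add0r.
  apply: (@pair_bound R a b k k_gt0 (ltW h1) ab b_le ba1 ak (ltW bk) M s q sM sq qM q1
    energy_constant G (jump_primitive jump_weight jump_place)
    (jump_drift jump_weight jump_place jump_weight' jump_place')) => //.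
  - move=> x Q dQ /andP[ax xb] dQx; apply: jump_primitive_derive => // i.
      exact: jump_weight_derive.
    by apply: jump_place_derive; lra.
  - by move=> x t xab; case: (bounds t xab).
  - by move=> x t xab; case: (bounds t xab).
  - by move=> x t xab; case: (bounds t xab).
have q0' i : (i < m)%N -> q`_i = 0 by move=> im; apply: q0; exact: ltnW.
pose D (e x : R) : R := diff_sum (powers (x ^+ k) m)
  (fun t => G x (t + e * (x ^+ k) ^+ m + q.[x ^+ k])).
have step (e : R) : `|e| <= 1 -> integral_le a b
    (fun x => x ^+ n * ((x - a) * (b - x)) * D e x)
    (4 ^+ m * pair_constant a b k M s energy_constant n).
  move=> e1; have coef i : (q + e *: 'X^m)`_i = if i == m then e else q`_i.
    rewrite coefD coefZ coefXn; case: eqP => [->|_]; last by rewrite mulr0 addr0.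
    by rewrite q0 // add0r mulr1.
  have := IH (q + e *: 'X^m) (ltnW mM).
  have E x : diff_sum (powers (x ^+ k) m) (fun t => G x (t + (q + e *: 'X^m).[x ^+ k])) = D e x.
    by apply: eq_diff_sum => t; rewrite hornerD hornerZ hornerXn addrA addrAC.
  under eq_fun do rewrite E; apply => //.
  - apply/leq_sizeP => j Mj; rewrite coef; case: eqP => [jm|_]; last by move/leq_sizeP : sq; apply.
    by move: Mj; rewrite jm ltnNge (ltnW mM).
  - by rewrite coef; case: eqP mM => [->|//]; rewrite ltnn.
  - by move=> i; rewrite coef; case: eqP.
  - by move=> i im; rewrite coef; case: eqP im => [->|_ im]; rewrite ?ltnn ?q0'.
have sq1 : `|1| <= 1 :> R by rewrite normr1.
have sqN1 : `|-1| <= 1 :> R by rewrite normrN normr1.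
have sq0 : `|0 : R| <= 1 by rewrite normr0.
have := integral_leD (integral_leD (integral_leZ (ler0n R 2) (step 0 sq0)) (step 1 sq1)) (step (-1) sqN1).
move/integral_le_trans; apply; last by rewrite exprS; lra.
move=> x xab; rewrite /=.
have -> : diff_sum (powers (x ^+ k) m) (fun t => G x (t + q.[x ^+ k])) = D 0 x.
  by apply: eq_diff_sum => t; rewrite mul0r addr0.
have -> : diff_sum (powers (x ^+ k) m) (fun t => G x (t + (x ^+ k) ^+ m + q.[x ^+ k])) = D 1 x.
  by apply: eq_diff_sum => t; rewrite mul1r.
have -> : diff_sum (powers (x ^+ k) m) (fun t => G x (t - (x ^+ k) ^+ m + q.[x ^+ k])) = D (-1) x.
  by apply: eq_diff_sum => t; rewrite mulN1r.
lra.
Qed.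

(** What remains of the energy of the increment after dropping all but [N] powers. *)
Definition energy_bound (n N : nat) (x : R) : R :=
  (x ^+ n / 4 ^+ N) * diff_sum (powers (x ^+ k) N) (G x).

(** The first term of the bound comes from the pairs of equal words, the others from the pairs that
    differ first at the exponent [M]. *)
Lemma energy_bound_integral_le (n N : nat) :
  (N == 0)%N || (k * N.-1 < n)%N -> (n <= k * N)%N -> 
  integral_le a b (fun x => (x - a) * (b - x) * energy_bound n N x)
    (energy_constant * (b ^+ n / 2 ^+ N) + \sum_(M < N)
      2 ^- (N - M) * pair_constant a b k M n.+1%:R energy_constant n).
Proof.
have [h1 h2 h3 h4] := ab_range.
move=> hN nkN.
have C0 : 0 <= energy_constant.
  by case: (bounds 0 (_ : a <= a <= b)) => [|_ _ _]; [rewrite lexx ltW|apply: le_trans].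
have pX (M : nat) : (M < N)%N -> integral_le a b (fun x => x ^+ n * ((x - a) * (b - x)) *
    diff_sum (powers (x ^+ k) M) (fun t => G x (t + (x ^+ k) ^+ M)))
    (4 ^+ M * pair_constant a b k M n.+1%:R energy_constant n).
  move=> MN; have kMn : (k * M <= n)%N.
    case/orP: hN => [/eqP N0|]; first by move: MN; rewrite N0.
    move/ltnW; apply: leq_trans; rewrite leq_mul2l -ltnS prednK ?MN ?orbT //.
    exact: leq_ltn_trans MN.
  have Mn : (M <= n)%N by apply: leq_trans kMn; rewrite leq_pmull.
  have h := @diff_sum_integral_le M M n n.+1%:R 'X^M (leqnn M).
  move: h; rewrite size_polyXn coefXn eqxx ler_nat => /(_ (leqnn _) erefl).
  case => //.
  - by move=> i; rewrite coefXn; case: eqP => _; rewrite ?normr1 ?normr0.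
  - by move=> i iM; rewrite coefXn ltn_eqF.
  move=> V [V' [dV uV hV]]; exists V, V'; split => // x xab.
  by have := uV x xab; rewrite hornerXn.
have I0 : integral_le a b (fun=> energy_constant * (b ^+ n / 2 ^+ N))
    (energy_constant * (b ^+ n / 2 ^+ N)).
  apply: integral_le_cst; rewrite ler_piMr // mulr_ge0 // divr_ge0 ?exprn_ge0 //; lra.
pose u (M : 'I_N) x := 4 ^- N * 2 ^+ (N - M) * (x ^+ n * ((x - a) * (b - x)) *
    diff_sum (powers (x ^+ k) M) (fun t => G x (t + (x ^+ k) ^+ M))).
have Iu (M : 'I_N) : integral_le a b (u M)
    (2 ^- (N - M) * pair_constant a b k M n.+1%:R energy_constant n).
  have := integral_leZ (_ : 0 <= 4 ^- N * 2 ^+ (N - M)) (pX M (ltn_ord M)).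
  have h0 : 0 <= 4 ^- N * 2 ^+ (N - M) :> R.
    by rewrite mulr_ge0 ?invr_ge0 ?exprn_ge0.
  move=> /(_ h0)/integral_le_trans; apply => //.
  have MN := ltnW (ltn_ord M).
  rewrite mulrA [X in X * _ <= _](_ : _ = 2 ^- (N - M)) //.
  have -> : 4 ^+ N = 4 ^+ M * (2 ^+ (N - M) * 2 ^+ (N - M)) :> R.
    rewrite -{1}(subnKC MN) exprD -exprMn; congr (_ * _ ^+ _); ring.
  by field; rewrite !expf_neq0.
apply: (integral_le_trans (integral_leD I0 (integral_le_sum (index_enum _) Iu))) => //.
move=> x xab; have /andP[ax xb] := xab.
have [_ _ _ G0] := bounds 0 xab.
rewrite /energy_bound diff_sum_powers; last exact: jump_kernel_even.
rewrite (mulrDr (x ^+ n / 4 ^+ N)) (mulrDr ((x - a) * (b - x))); apply: lerD.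
  have p0 : 0 <= (x - a) * (b - x) by rewrite mulr_ge0; lra.
  have p1 : (x - a) * (b - x) <= 1 by rewrite -[leRHS]mulr1; apply: ler_pM; lra.
  have xb' : x ^+ n <= b ^+ n by apply: lerXn2r; rewrite ?nnegrE; lra.
  have xn0 : 0 <= x ^+ n by rewrite exprn_ge0 //; lra.
  have -> : x ^+ n / 4 ^+ N * (2 ^+ N * G x 0) = x ^+ n / 2 ^+ N * G x 0.
    have -> : 4 ^+ N = 2 ^+ N * 2 ^+ N :> R by rewrite -exprMn; congr (_ ^+ _); ring.
    by field; rewrite !expf_neq0.
  have GC : G x 0 <= energy_constant := le_trans (ler_norm _) G0.
  apply: (@le_trans _ _ (1 * (x ^+ n / 2 ^+ N * energy_constant))).
    apply: (@le_trans _ _ ((x - a) * (b - x) * (x ^+ n / 2 ^+ N * energy_constant))).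
      by apply: ler_wpM2l => //; apply: ler_wpM2l => //; exact: divr_ge0.
    by apply: ler_wpM2r => //; apply: mulr_ge0 => //; apply: divr_ge0 => //; exact: exprn_ge0.
  rewrite mul1r mulrC; apply: ler_wpM2l => //.
  by apply: ler_wpM2r => //; rewrite invr_ge0; exact: exprn_ge0.
rewrite mulr_sumr mulr_sumr; apply: ler_sum => M _.
rewrite [leRHS](_ : _ = (x - a) * (b - x) * (x ^+ n / 4 ^+ N *
  (2 ^+ (N - M) * diff_sum (powers (x ^+ k) M) (fun t => G x (t + (x ^+ k) ^+ M))))) //.
by rewrite /u; ring.
Qed.

End integrated_energy.

(** * Exponential decay of the averaged energy *)

Section ceil_div.
Variables (k : nat) (k_gt0 : (0 < k)%N).

(** The number of exponents below [n] that are divisible by [k]. *)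
Definition ceil_div n := ((n + k.-1) %/ k)%N.

Lemma ceil_div_ge n : (n <= k * ceil_div n)%N.
Proof.
have := ltn_ceil (n + k.-1) k_gt0; rewrite -/(ceil_div n) mulnC mulnS.
by move: k_gt0; move: (k * _)%N => kN; lia.
Qed.

Lemma ceil_div_lt n : (ceil_div n == 0)%N || (k * (ceil_div n).-1 < n)%N.
Proof.
have := leq_trunc_div (n + k.-1) k; rewrite -/(ceil_div n) mulnC.
case: (ceil_div n) => //= N; rewrite mulnS; move: k_gt0; move: (k * N)%N => kN.
lia.
Qed.

Lemma ceil_div_le n : (ceil_div n <= n)%N.
Proof.
have := ceil_div_lt n; case: (ceil_div n) => //= N; apply: leq_ltn_trans.
by rewrite leq_pmull.
Qed.

End ceil_div.

Section exponential_bound.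
Context {R : realType}.
Variables (a b : R) (k : nat).
Hypotheses (k_gt0 : (0 < k)%N) (a1 : 1 < a) (ab : a < b) (b_le : b <= 2)
  (ba1 : b - a <= 1) (ak : 25 / 16 <= a ^+ k) (bk : b ^+ k < 2).

Local Notation G := (jump_kernel jump_weight jump_place).

Let ab_range : [/\ 1 < a, a < b, b <= 2 & b - a <= 1]. Proof. by split. Qed.

(** The contribution of [M] is at most a power of [n] times [(b^k / 2)^(N - M) (a^(- k))^M]. Both
    ratios are below 1. *)
Lemma energy_bound_exponential : exists C r : R, [/\ 0 < C, 0 < r < 1 &
  forall n, integral_le a b
    (fun x => (x - a) * (b - x) * energy_bound k n (ceil_div k n) x) (C * r ^+ n)].
Proof.
have [h1 h2 h3 h4] := ab_range.
have hak : 25 / 16 <= a ^+ k by []. have hbk : b ^+ k < 2 by [].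
have ak0 : 0 < a ^+ k by lra.
pose rho := Num.max (b ^+ k / 2) (a ^+ k)^-1.
have iak0 : 0 < (a ^+ k)^-1 by rewrite invr_gt0.
have iak1 : (a ^+ k)^-1 < 1 by rewrite invf_lt1 //; lra.
have rho0 : 0 < rho by rewrite lt_max iak0 orbT.
have rho1 : rho < 1 by rewrite gt_max iak1 andbT; lra.
have [|r hr rk] := @root_below R k rho k_gt0; first by rewrite rho0.
have [C' [r' [C'0 hr' pg]]] := @poly_geometric R 8 r hr.
have /andP[r0 r1] := hr.
have [C CE] : exists C, C = energy_constant a by exists (energy_constant a).
have C0 : 0 <= C.
  rewrite CE /energy_constant /jump_constant card_ord.
  by have := jump_size_ge1 h1; move: (jump_size a) => J J1;
    rewrite !mulr_ge0 ?addr_ge0 ?exprn_ge0 //; lra.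
have [K KE] : exists K, K = C * (8 * 137) * (278 * 8) by eexists.
have K0 : 0 <= K by rewrite KE; lra.
exists ((C + K + 1) * C'), r'; split => //; first by rewrite mulr_gt0 //; lra.
move=> n; set N := ceil_div k n.
pose s : R := n.+1%:R.
have s1 : 1 <= s by rewrite ler1n.
have nN : (n <= k * N)%N := ceil_div_ge k_gt0 n.
have rhoN : rho ^+ N <= r ^+ n.
  apply: (@le_trans _ _ ((r ^+ k) ^+ N)).
    by apply: lerXn2r; rewrite ?nnegrE ?exprn_ge0 // ltW.
  by rewrite -exprM; apply: ler_wiXn2l => //; exact: ltW.
have h := energy_bound_integral_le k_gt0 a1 ab b_le ba1 ak bk (ceil_div_lt k_gt0 n) nN.
apply: (integral_le_trans h) => //.
have rN0 : 0 <= rho ^+ N by rewrite exprn_ge0 // ltW.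
have first_term : energy_constant a * (b ^+ n / 2 ^+ N) <= C * (s ^+ 8 * rho ^+ N).
  rewrite -CE; apply: ler_wpM2l => //.
  apply: (@le_trans _ _ (rho ^+ N)).
    apply: (@le_trans _ _ ((b ^+ k / 2) ^+ N)).
      rewrite exprMn exprVn -exprM; apply: ler_wpM2r; first by rewrite invr_ge0 exprn_ge0.
      by apply: ler_weXn2l => //; lra.
    apply: lerXn2r; rewrite ?nnegrE ?(ltW rho0) ?divr_ge0 ?exprn_ge0 //; first lra.
    by rewrite le_max lexx.
  by rewrite ler_peMl // exprn_ege1.
have term (M : 'I_N) : 2 ^- (N - M) * pair_constant a b k M n.+1%:R (energy_constant a) n
    <= K * (s ^+ 7 * rho ^+ N).
  have MN := ltnW (ltn_ord M).
  have -> : 2 ^- (N - M) * pair_constant a b k M n.+1%:R (energy_constant a) n =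
     (C * (8 * 137) * s ^+ 4 * ((270 * s ^+ 3 + 8) * 8)) *
     (2 ^- (N - M) * b ^+ (n - k * M) * a ^- (k * M)).
    rewrite -CE /pair_constant -/s; ring.
  have -> : K * (s ^+ 7 * rho ^+ N) =
     (C * (8 * 137) * s ^+ 4 * ((278 * s ^+ 3) * 8)) * rho ^+ N by rewrite KE; ring.
  have s3 : 1 <= s ^+ 3 by rewrite exprn_ege1.
  have s4 : 0 <= s ^+ 4 by rewrite exprn_ge0 //; lra.
  apply: ler_pM.
  - by apply: mulr_ge0; [apply: mulr_ge0 s4|]; lra.
  - by rewrite !mulr_ge0 ?invr_ge0 ?exprn_ge0 //; lra.
  - apply: ler_wpM2l; first by apply: mulr_ge0 s4; lra.
    by apply: ler_wpM2r => //; lra.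
  have -> : rho ^+ N = rho ^+ M * rho ^+ (N - M) by rewrite -exprD subnKC.
  rewrite mulrC.
  apply: ler_pM.
  - by rewrite invr_ge0 exprn_ge0 //; lra.
  - by rewrite mulr_ge0 ?invr_ge0 ?exprn_ge0 //; lra.
  - rewrite exprM -exprVn; apply: lerXn2r; rewrite ?nnegrE ?(ltW rho0) ?(ltW iak0) //.
    by rewrite le_max lexx orbT.
  apply: (@le_trans _ _ ((b ^+ k / 2) ^+ (N - M))).
    rewrite exprMn exprVn mulrC; apply: ler_wpM2r; first by rewrite invr_ge0 exprn_ge0.
    rewrite -exprM mulnBr; apply: ler_weXn2l; first lra.
    exact: leq_sub2r.
  apply: lerXn2r; rewrite ?nnegrE ?(ltW rho0) ?divr_ge0 ?exprn_ge0 //; first lra.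
  by rewrite le_max lexx.
apply: le_trans (lerD first_term (ler_sum _ (fun M _ => term M))) _.
rewrite sumr_const card_ord -[X in _ + X <= _]mulr_natl.
have Ns : (N%:R : R) <= s by rewrite ler_nat; apply: leqW; exact: ceil_div_le.
have T : N%:R * (K * (s ^+ 7 * rho ^+ N)) <= K * (s ^+ 8 * rho ^+ N).
  have -> : K * (s ^+ 8 * rho ^+ N) = s * (K * (s ^+ 7 * rho ^+ N)) by ring.
  apply: ler_wpM2r Ns; apply: mulr_ge0 K0 _; apply: mulr_ge0 rN0.
  by apply: exprn_ge0; lra.
have X0 : 0 <= s ^+ 8 * rho ^+ N by rewrite mulr_ge0 // exprn_ge0 //; lra.
apply: (@le_trans _ _ ((C + K + 1) * (s ^+ 8 * rho ^+ N))).
  move: T X0; move: (s ^+ 8 * rho ^+ N) (N%:R * _) => X Y hY hX.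
  by move: hY; lra.
rewrite -mulrA; apply: ler_wpM2l; first lra.
apply: le_trans (pg n); apply: ler_wpM2l => //.
by rewrite exprn_ge0 //; lra.
Qed.

End exponential_bound.

(** * Exponential decay for almost every base *)

Section geometric_weights.
Context {R : realType}.
Local Notation mu := (@lebesgue_measure R).
Variables (D : set (measurableTypeR R)) (u : nat -> measurableTypeR R -> R)
  (C r s : R).
Hypotheses (mD : measurable D) (mu_u : forall n, measurable_fun D (u n))
  (u_ge0 : forall n x, D x -> 0 <= u n x) (C_ge0 : 0 <= C) (r_gt0 : 0 < r) (r_lt_s : r < s)
  (int_u : forall n, (\int[mu]_(x in D) (u n x)%:E <= (C * r ^+ n)%:E)%E).

(** Its finiteness at a point expresses geometric decay of [u n] at that point. *)
Definition weighted_series (x : measurableTypeR R) : \bar R := (\sum_(n <oo) (s ^- n * u n x)%:E)%E.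

Let s_gt0 : 0 < s. Proof. exact: lt_trans r_gt0 r_lt_s. Qed.

Let term_ge0 n x : D x -> (0 <= (s ^- n * u n x)%:E)%E.
Proof.
by move=> Dx; rewrite lee_fin mulr_ge0 ?u_ge0 // invr_ge0 exprn_ge0 // ltW.
Qed.

Lemma weighted_series_ge0 x : D x -> (0 <= weighted_series x)%E.
Proof. by move=> Dx; apply: nneseries_ge0 => n _ _; exact: term_ge0. Qed.

Let mterm n : measurable_fun D (EFin \o (fun x => s ^- n * u n x)).
Proof. by apply/measurable_EFinP; apply: measurable_funM. Qed.

Lemma weighted_series_integrable : mu.-integrable D weighted_series.
Proof.
have mw : measurable_fun D weighted_series.
  by apply: ge0_emeasurable_sum => [n x Dx _|n _]; [exact: term_ge0|exact: mterm].
apply/integrableP; split => //.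
rewrite (_ : (\int[mu]_(x in D) `|weighted_series x|)%E =
  (\int[mu]_(x in D) weighted_series x)%E); last first.
  by apply: eq_integral => x /[!inE] Dx; rewrite gee0_abs // weighted_series_ge0.
rewrite integral_nneseries //.
have q1 : `|r / s| < 1.
  by rewrite ger0_norm ?divr_ge0 ?ltW // ltr_pdivrMr // mul1r.
apply: (@le_lt_trans _ _ (C * (1 - r / s)^-1)%:E); last exact: ltry.
apply: lime_le.
  apply: is_cvg_nneseries => n _ _; apply: integral_ge0 => x Dx; exact: term_ge0.
apply: nearW => n.
apply: (@le_trans _ _ (\sum_(0 <= i < n) (geometric C (r / s) i)%:E)%E).
  apply: lee_sum => i _.
  rewrite (eq_integral (fun x => (s ^- i)%:E * (u i x)%:E)%E) //.
  rewrite ge0_integralZl_EFin //; last 3 first.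
    by move=> x Dx; rewrite lee_fin u_ge0.
    exact/measurable_EFinP.
    by rewrite invr_ge0 exprn_ge0 // ltW.
  rewrite /geometric /= expr_div_n.
  rewrite (_ : C * (r ^+ i / s ^+ i) = s ^- i * (C * r ^+ i)); last ring.
  rewrite EFinM; apply: lee_wpmul2l => //.
  by rewrite lee_fin invr_ge0 exprn_ge0 // ltW.
rewrite sumEFin lee_fin; have := @geometric_le_lim R n C (r / s) C_ge0 (divr_gt0 r_gt0 s_gt0) q1.
by rewrite /series /= .
Qed.

Lemma weighted_series_partial n x : D x -> weighted_series x \is a fin_num ->
  \sum_(0 <= i < n) s ^- i * u i x <= fine (weighted_series x).
Proof.
move=> Dx wx; rewrite -lee_fin fineK // -sumEFin.
exact: (@nneseries_lim_ge R _ xpredT 0 n (fun i _ _ => term_ge0 i Dx)).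
Qed.

Lemma weighted_series_bound n x : D x -> weighted_series x \is a fin_num ->
  u n x <= fine (weighted_series x) * s ^+ n.
Proof.
move=> Dx wx; rewrite -ler_pdivrMr ?exprn_gt0 // mulrC.
apply: le_trans (weighted_series_partial n.+1 Dx wx).
rewrite big_nat_recr //= lerDr; apply: sumr_ge0 => i _.
by rewrite -lee_fin; exact: term_ge0.
Qed.

Lemma ae_geometric_bound :
  {ae mu, forall x, D x -> exists C' : R, forall n, u n x <= C' * s ^+ n}.
Proof.
have := integrable_ae mD weighted_series_integrable; apply: filterS => x wx Dx.
by exists (fine (weighted_series x)) => n; apply: weighted_series_bound => //; exact: wx.
Qed.

End geometric_weights.

Section almost_every_base.
Context {R : realType}.
Local Notation mu := (@lebesgue_measure R).
Local Notation G := (jump_kernel jump_weight jump_place).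

(** By [increment_norm], exponential decay of the L2 norms of the increments. *)
Definition exponential_increments (b : R) := exists C r : R, [/\ 0 <= C, 0 < r < 1 &
  forall n, (b / 4) ^+ n * diff_sum (powers b n) (G b) <= C * r ^+ n].

Lemma cvg_sumR (I : Type) (r : seq I) (F : I -> R -> R) (x : R) :
  (forall i, {for x, continuous (F i)}) ->
  {for x, continuous (fun y => \sum_(i <- r) F i y)}.
Proof.
move=> h; elim: r => [|i r IH].
  rewrite (_ : (fun _ => _) = fun=> 0); first exact: cst_continuous.
  by apply/funext => y; rewrite big_nil.
rewrite (_ : (fun _ => _) = fun y => F i y + \sum_(j <- r) F j y).
  by apply: cvgD; [exact: h|exact: IH].
by apply/funext => y; rewrite big_cons.
Qed.

Lemma diff_sum_continuous (F : R -> R -> R) (k N : nat) (x : R) :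
  (forall Q : R -> R, {for x, continuous Q} -> {for x, continuous (fun y : R => F y (Q y))}) ->
  {for x, continuous (fun y : R => diff_sum (powers (y ^+ k) N) (F y))}.
Proof.
elim: N F => [|N IH] F hF; first by apply: hF; exact: cst_continuous.
have cB : {for x, continuous (fun y : R => (y ^+ k) ^+ N)}.
  rewrite (_ : (fun _ => _) = fun y : R => y ^+ (k * N)).
    exact: has_derive_continuous (has_deriveX _ x).
  by apply/funext => y; rewrite exprM.
apply: cvgD; first apply: cvgD.
- by apply: cvgM; [exact: cvg_cst|exact: IH].
- apply: (IH (fun y t => F y (t + (y ^+ k) ^+ N))) => Q cQ.
  by apply: (hF (fun y => Q y + (y ^+ k) ^+ N)); apply: cvgD.
- apply: (IH (fun y t => F y (t - (y ^+ k) ^+ N))) => Q cQ.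
  by apply: (hF (fun y => Q y - (y ^+ k) ^+ N)); apply: cvgB.
Qed.

Lemma jump_kernel_continuous (x : R) (Q : R -> R) : 1 < x -> {for x, continuous Q} ->
  {for x, continuous (fun y : R => G y (Q y))}.
Proof.
move=> x1 cQ.
have cw i : {for x, continuous (@jump_weight R i)}.
  exact: has_derive_continuous (jump_weight_derive i x).
have cp i : {for x, continuous (@jump_place R i)}.
  exact: has_derive_continuous (jump_place_derive i x1).
apply: cvgM; first exact: cvg_cst.
apply: cvg_sumR => i; apply: cvg_sumR => j.
apply: cvgM; first by apply: cvgM; [exact: cw|exact: cw].
apply: cvg_norm; apply: cvgD; first exact: cQ.
by apply: cvgB; [exact: cp|exact: cp].
Qed.

(** Only the exponents divisible by [k] are kept. *)
Lemma energy_le_energy_bound (b : R) k n : (0 < k)%N -> 1 < b ->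
  (b / 4) ^+ n * diff_sum (powers b n) (G b) <= energy_bound k n (ceil_div k n) b.
Proof.
move=> k0 b1; have sub := subseq_powers b k0 (ceil_div_lt k0 n).
have le := diff_sum_subseq sub (jump_kernel_pos_def b1).
rewrite !size_powers in le.
have Nn := ceil_div_le k0 n.
rewrite /energy_bound.
have -> : b ^+ n / 4 ^+ ceil_div k n = (b / 4) ^+ n * 4 ^+ (n - ceil_div k n).
  have E4 : 4 ^+ n = 4 ^+ (n - ceil_div k n) * 4 ^+ ceil_div k n :> R.
    by rewrite -exprD subnK.
  by rewrite exprMn exprVn E4; field; rewrite !expf_neq0.
rewrite -mulrA; apply: ler_wpM2l => //.
by rewrite exprn_ge0 // divr_ge0 //; lra.
Qed.

Lemma energy_bound_ge0 (b : R) k n N : 1 < b -> 0 <= energy_bound k n N b.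
Proof.
move=> b1; rewrite /energy_bound mulr_ge0 //.
  by rewrite divr_ge0 // exprn_ge0 //; lra.
exact: diff_sum_ge0 (jump_kernel_pos_def b1).
Qed.

Lemma ae_exponential_increments_itv (a b : R) (k : nat) :
  (0 < k)%N -> 1 < a -> a < b -> b <= 2 -> b - a <= 1 ->
  25 / 16 <= a ^+ k -> b ^+ k < 2 ->
  {ae mu, forall x, a < x < b -> exponential_increments x}.
Proof.
move=> k0 a1 ab b2 ba1 ak bk.
have [C [r [C0 /andP[r0 r1] hI]]] := energy_bound_exponential k0 a1 ab b2 ba1 ak bk.
pose s := (r + 1) / 2.
pose u n x := (x - a) * (b - x) * energy_bound k n (ceil_div k n) x.
have cu n x : a <= x <= b -> {for x, continuous (u n)}.
  move=> /andP[ax xb]; apply: cvgM.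
    apply: cvgM; first by apply: cvgB; [exact: cvg_id|exact: cvg_cst].
    by apply: cvgB; [exact: cvg_cst|exact: cvg_id].
  apply: cvgM.
    apply: cvgM; last exact: cvg_cst.
    exact: has_derive_continuous (has_deriveX _ x).
  by apply: diff_sum_continuous => Q; apply: jump_kernel_continuous; lra.
have u0 n x : `[a, b]%classic x -> 0 <= u n x.
  rewrite /= in_itv /= => /andP[ax xb]; rewrite mulr_ge0 //; first by rewrite mulr_ge0; lra.
  by apply: energy_bound_ge0; lra.
have mu_u n : measurable_fun `[a, b] (u n).
  apply: subspace_continuous_measurable_fun => //.
  by apply: continuous_in_subspaceT => x; rewrite inE /= in_itv /=; exact: cu.
have Iu n : (\int[mu]_(x in `[a, b]) (u n x)%:E <= (C * r ^+ n)%:E)%E.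
  exact: (integral_leP ab (cu n) (hI n)).
have s0 : 0 < s by rewrite /s; lra.
have rs : r < s by rewrite /s; lra.
have := @ae_geometric_bound R `[a, b] u C r s (measurable_itv _) mu_u u0 (ltW C0) r0 rs Iu.
apply: filterS => x h /andP[ax xb].
have [|C' hC'] := h; first by rewrite /= in_itv /= !ltW.
have w0 : 0 < (x - a) * (b - x) by rewrite mulr_gt0; lra.
exists (`|C'| / ((x - a) * (b - x))), s; split.
- by rewrite divr_ge0 // ltW.
- by rewrite s0 /s; lra.
move=> n; apply: (le_trans (energy_le_energy_bound n k0 _)); first lra.
rewrite mulrAC ler_pdivlMr // mulrC; apply: le_trans (hC' n) _.
by apply: ler_wpM2r; [apply: exprn_ge0; exact: ltW|exact: ler_norm].
Qed.

(** If [x >= 63/50], the exponent 2 does. Otherwise the first power of [x] above [79/50] is below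
    [63/50 * 79/50 < 2]. *)
Lemma exists_exponent (x : R) : 1 < x -> x < Num.sqrt 2 ->
  exists2 k : nat, (0 < k)%N & 25 / 16 < x ^+ k /\ x ^+ k < 2.
Proof.
move=> x1 xs.
have x2 : x ^+ 2 < 2.
  have <- : Num.sqrt 2 ^+ 2 = 2 :> R by rewrite sqr_sqrtr.
  by apply: ltrXn2r => //; rewrite ?nnegrE ?sqrtr_ge0 //; lra.
have [h|h] := leP (63 / 50) x.
  exists 2%N => //; split => //; nra.
have ex : exists n, 79 / 50 < x ^+ n.
  have bern n : 1 + n%:R * (x - 1) <= x ^+ n.
    elim: n => [|n IH]; first by rewrite mul0r addr0 expr0.
    rewrite exprS -natr1; have x0 : 0 <= x by lra.
    have := ler_wpM2l x0 IH.
    have d0 : 0 <= x - 1 by lra.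
    have := mulr_ge0 (mulr_ge0 (ler0n R n) d0) d0; lra.
  have d0 : 0 < x - 1 by lra.
  have i0 : 0 <= (x - 1)^-1 by rewrite invr_ge0 ltW.
  have := archi_boundP i0; set n := Num.bound _ => hn.
  exists n; apply: lt_le_trans (bern _).
  have : (x - 1)^-1 * (x - 1) < n%:R * (x - 1) by rewrite ltr_pM2r.
  rewrite mulVf ?gt_eqF //; lra.
case: (ex_minnP ex) => k hk kmin.
have k0 : (0 < k)%N by case: k hk kmin => // h1 _; exfalso; move: h1; rewrite expr0; lra.
exists k => //; split; first lra.
have := kmin k.-1; rewrite leqNgt prednK // leqnn /= => /contraFN => /(_ erefl).
rewrite -leNgt => hk'.
have -> : x ^+ k = x * x ^+ k.-1 by rewrite -exprS prednK.
apply: (@le_lt_trans _ _ (63 / 50 * (79 / 50))); last lra.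
by apply: ler_pM => //; [lra|apply: exprn_ge0; lra|exact: ltW].
Qed.

(** Countably many intervals with rational endpoints, one family for each exponent, suffice. *)
Lemma ae_exponential_increments :
  {ae mu, forall x, 1 < x < Num.sqrt 2 -> exponential_increments x}.
Proof.
pose T := (nat * (rat * rat))%type.
pose P (t : T) (x : measurableTypeR R) := (0 < t.1)%N -> 1 < ratr t.2.1 :> R -> ratr t.2.1 < ratr t.2.2 :> R ->
  ratr t.2.2 <= 2 :> R -> ratr t.2.2 - ratr t.2.1 <= 1 :> R ->
  25 / 16 <= ratr t.2.1 ^+ t.1 :> R -> ratr t.2.2 ^+ t.1 < 2 :> R ->
  ratr t.2.1 < x < ratr t.2.2 -> exponential_increments x.
have aeP t : {ae mu, forall x, P t x}.
  have [h|h] := pselect [/\ (0 < t.1)%N, 1 < ratr t.2.1 :> R, ratr t.2.1 < ratr t.2.2 :> R,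
     ratr t.2.2 <= 2 :> R & [/\ ratr t.2.2 - ratr t.2.1 <= 1 :> R,
     25 / 16 <= ratr t.2.1 ^+ t.1 :> R & ratr t.2.2 ^+ t.1 < 2 :> R]].
    have [h1 h2 h3 h4 [h5 h6 h7]] := h.
    have := ae_exponential_increments_itv h1 h2 h3 h4 h5 h6 h7.
    apply: (@filterS _ _ (ae_filter_ringOfSetsType mu)) => x hx g1 g2 g3 g4 g5 g6 g7; exact: hx.
  by apply: aeW => x h1 h2 h3 h4 h5 h6 h7; exfalso; apply: h; split => //; split.
have aeT : {ae mu, forall x, forall n : nat, forall t : T, unpickle n = Some t -> P t x}.
  apply: ae_foralln => n; case E : (unpickle n) => [t|]; last exact: aeW.
  have := aeP t; apply: (@filterS _ _ (ae_filter_ringOfSetsType mu)) => x Px t' [<-]; exact: Px.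
move: aeT; apply: (@filterS _ _ (ae_filter_ringOfSetsType mu)) => x hx /andP[x1 xs].
have [k k0 [kl ku]] := exists_exponent x1 xs.
have x2 : x < 2.
  apply: lt_le_trans xs _; rewrite -[leRHS]ger0_norm // -sqrtr_sqr ler_wsqrtr //.
  by rewrite expr2; lra.
have cX : {for x, continuous (fun y : R => y ^+ k)}.
  exact: has_derive_continuous (has_deriveX k x).
have hnear : \forall y \near x, [/\ 1 < y, y < 2, 25 / 16 < y ^+ k, y ^+ k < 2 & `|x - y| < 1 / 2].
  near=> y; split.
  - by near: y; exact: lt_nbhsr.
  - by near: y; exact: lt_nbhsl.
  - by near: y; apply: (cX [set z | 25 / 16 < z]); exact: lt_nbhsr.
  - by near: y; apply: (cX [set z | z < 2]); exact: lt_nbhsl.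
  - near: y; apply/nbhs_ballP; exists (1 / 2) => //=; lra.
have [e /= e0 he] := (nbhs_ballP _ _).1 hnear.
(* Rational endpoints are taken so close to [x] that all strict inequalities persist. *)
have inball y : x - e < y < x + e -> [/\ 1 < y, y < 2, 25 / 16 < y ^+ k, y ^+ k < 2 & `|x - y| < 1 / 2].
  by move=> /andP[h1 h2]; apply: he; rewrite /ball /= ltr_norml; apply/andP; split; lra.
have [|p] := @rat_in_itvoo R (x - e) x; first lra.
rewrite in_itv /= => /andP[p1 p2].
have [|q] := @rat_in_itvoo R x (x + e); first lra.
rewrite in_itv /= => /andP[q1 q2].
have [|a1 a2 a3 a4 a5] := inball (ratr p); first by apply/andP; split; lra.
have [|b1 b2 b3 b4 b5] := inball (ratr q); first by apply/andP; split; lra.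
apply: (hx (pickle ((k, (p, q)) : T)) (k, (p, q))) => //=.
- exact: pickleK.
- lra.
- exact: ltW.
- by move: a5 b5; rewrite !ltr_norml => /andP[? ?] /andP[? ?]; lra.
- exact: ltW.
- by rewrite p2 q1.
Unshelve. all: by end_near.
Qed.

End almost_every_base.

(** * Convergence of the normalised counts *)

Section smoothed_counts.
Context {R : realType}.
Local Notation mu := (@lebesgue_measure R).
Variables (b : R) (b1 : 1 < b).

Lemma half_open_ge0 y : 0 <= half_open b y.
Proof.
rewrite /half_open subr_ge0 ler_nat; case: (leP _ y) => // Ly.
by rewrite (le_trans _ Ly) // invr_ge0 subr_ge0 ltW.
Qed.

Lemma half_open_out y : y < 0 \/ (b - 1)^-1 <= y -> half_open b y = 0.
Proof.
have L0 : 0 < (b - 1)^-1 by rewrite invr_gt0 subr_gt0.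
rewrite /half_open => -[y0|Ly].
  by rewrite !leNgt y0 (lt_trans y0 L0) subrr.
by rewrite Ly (le_trans (ltW L0) Ly) subrr.
Qed.

(** Orbits that leave the interval never come back. *)
Lemma Tword_out (w : seq bool) x : x < 0 \/ (b - 1)^-1 <= x ->
  Tword b w x < 0 \/ (b - 1)^-1 <= Tword b w x.
Proof.
have h1 : 1 < b := b1.
elim: w x => [|a w IH] x //= hx; apply: IH; rewrite /Tdigit; case: hx => hx.
  left; have : b * x < 0 by rewrite pmulr_rlt0 //; lra.
  by have := ler0n R a; lra.
right; have d0 : 0 < b - 1 by lra.
have : b * (b - 1)^-1 <= b * x by rewrite ler_wpM2l //; lra.
have -> : b * (b - 1)^-1 = (b - 1)^-1 + 1 by field; rewrite gt_eqF.
have : (a%:R : R) <= 1 by case: (a).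
lra.
Qed.

Lemma smoothed_count_words n x :
  smoothed_count b n x = (b / 2) ^+ n * \sum_(w : n.-tuple bool) half_open b (Tword b w x).
Proof. by rewrite (sum_words _ _ _ (half_open b)). Qed.

Lemma smoothed_count_ge0 n x : 0 <= smoothed_count b n x.
Proof.
have h1 : 1 < b := b1.
rewrite smoothed_count_words mulr_ge0 ?exprn_ge0 //; first lra.
by apply: sumr_ge0 => w _; exact: half_open_ge0.
Qed.

Lemma smoothed_count_out n x : x < 0 \/ (b - 1)^-1 <= x -> smoothed_count b n x = 0.
Proof.
move=> hx; rewrite smoothed_count_words big1 ?mulr0 // => w _.
exact/half_open_out/Tword_out.
Qed.

Lemma measurable_step (K p c : R) :
  measurable_fun setT (fun x : measurableTypeR R => (c <= K * x - p)%R%:R : R).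
Proof.
have -> : (fun x : measurableTypeR R => (c <= K * x - p)%R%:R : R) =
   \1_(`[c, +oo[%classic) \o (fun x : measurableTypeR R => K * x - p).
  apply/funext => x /=; rewrite indicE; congr ((nat_of_bool _)%:R).
  by apply/idP/idP => [h|]; rewrite inE /= in_itv /= andbT.
apply: measurableT_comp; first exact: measurable_indic.
apply: measurable_funB => //; exact: measurable_funM.
Qed.

Lemma measurable_smoothed_count n :
  measurable_fun setT (smoothed_count b n : measurableTypeR R -> R).
Proof.
have ms c (F : R -> measurableTypeR R -> R) : (forall p, measurable_fun setT (F p)) ->
    measurable_fun setT (fun x => subset_sum c (fun p => F p x)).
  elim: c F => [|d c IH] F mF /=; first exact: mF.
  apply: measurable_funD; first exact: IH.
  by apply: (IH (fun p => F (p + d))).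
apply: measurable_funM => //.
apply: (ms _ (fun p x => half_open b (b ^+ n * x - p))) => p.
by apply: measurable_funB; exact: measurable_step.
Qed.

Lemma integrates_smoothed_count n : integrates (smoothed_count b n) (b - 1)^-1.
Proof.
have h1 : 1 < b := b1.
set L := (b - 1)^-1; have L0 : 0 < L by rewrite invr_gt0 subr_gt0.
have K0 : 0 < b ^+ n by rewrite exprn_gt0 //; lra.
have cst (c : seq R) (v : R) : subset_sum c (fun=> v) = 2 ^+ size c * v.
  by elim: c => [|d c IH] /=; rewrite ?mul1r // IH exprS; ring.
have h p : integrates (fun x => half_open b (b ^+ n * x - p)) ((b ^+ n)^-1 * L).
  have := @integrates_itv R ((b ^+ n)^-1 * p) ((b ^+ n)^-1 * (p + L)).
  rewrite ler_pM2l ?invr_gt0 // lerDl -mulrBr addrAC subrr add0r => /(_ (ltW L0)).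
  apply: eq_integrates => x; rewrite /half_open !ler_pdivrMl //.
  by rewrite subr_ge0 -lerBrDl.
have := integratesZ ((b / 2) ^+ n) (integrates_subset_sum (powers b n) h).
rewrite cst size_powers (_ : (b / 2) ^+ n * (2 ^+ n * ((b ^+ n)^-1 * L)) = L) //.
rewrite exprMn exprVn; field; rewrite !gt_eqF // exprn_gt0 //.
Qed.

(** The upper limit is measurable and defined everywhere. It is the limit where there is one. *)
Definition limit_density (x : measurableTypeR R) : R :=
  fine (limn_esup (fun n => (smoothed_count b n x)%:E)).

Lemma measurable_limit_density : measurable_fun setT limit_density.
Proof.
apply: (@measurableT_comp _ _ _ _ _ _ fine) => //.
apply: measurable_fun_limn_esup => n.
by apply/measurable_EFinP; exact: measurable_smoothed_count.
Qed.

Lemma limit_density_ge0 x : 0 <= limit_density x.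
Proof.
apply: fine_ge0; apply: (@le_trans _ _ (limn_einf (fun n => (smoothed_count b n x)%:E))).
  rewrite limn_einf_lim; apply: lime_ge; first exact: is_cvg_einfs.
  apply: nearW => n; apply: le_ereal_inf_tmp => _ [m _ <-].
  by rewrite lee_fin smoothed_count_ge0.
exact: limn_einf_sup.
Qed.

Lemma cvg_limit_density x (l : R) : smoothed_count b n x @[n --> \oo] --> l ->
  smoothed_count b n x @[n --> \oo] --> limit_density x.
Proof.
move=> h; suff -> : limit_density x = l by [].
have /cvg_limn_einf_sup[_] : (smoothed_count b n x)%:E @[n --> \oo] --> l%:E.
  by apply: cvg_EFin; [exact: nearW|exact: h].
by rewrite /limit_density => ->.
Qed.

Hypothesis hinc : exponential_increments b.

Let D : set (measurableTypeR R) := `[0, (b - 1)^-1]%classic.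

Let increment_square n (x : measurableTypeR R) : R :=
  (smoothed_count b n.+1 x - smoothed_count b n x) ^+ 2.

(** The arithmetic-geometric inequality [2 |d| <= s^n + s^(- n) d^2] bounds the sum of the
    increments by the weighted sum of their squares, which is integrable. The same bound serves
    for absolute convergence and as a dominating function. *)
Lemma smoothed_count_converges : exists g : measurableTypeR R -> R,
  [/\ mu.-integrable D (EFin \o g),
      {ae mu, forall x, D x -> forall n, smoothed_count b n x <= g x} &
      {ae mu, forall x, D x -> smoothed_count b n x @[n --> \oo] --> limit_density x}].
Proof.
have h1 : 1 < b := b1.
have [C [r [C0 /andP[r0 r1] hCr]]] := hinc.
pose s := (r + 1) / 2.
have s0 : 0 < s by rewrite /s; lra.
have s1 : s < 1 by rewrite /s; lra.
have rs : r < s by rewrite /s; lra.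
have mD : measurable D by exact: measurable_itv.
have mu_u n : measurable_fun D (increment_square n).
  apply: measurable_funX; apply: measurable_funB; apply: measurable_funTS;
    exact: measurable_smoothed_count.
have u0 n x : D x -> 0 <= increment_square n x by move=> _; exact: sqr_ge0.
have Iu n : (\int[mu]_(x in D) (increment_square n x)%:E <= (C * r ^+ n)%:E)%E.
  have [ii iv] := increment_norm n h1.
  apply: (@le_trans _ _ (\int[mu]_x (increment_square n x)%:E)%E).
    apply: ge0_subset_integral => //.
      by apply: measurable_int ii.
    by move=> x _; rewrite lee_fin sqr_ge0.
  by rewrite iv lee_fin.
have wi := @weighted_series_integrable R D _ C r s mD mu_u u0 C0 r0 rs Iu.
have wb := @weighted_series_bound R D _ r s u0 r0 rs.
have wp := @weighted_series_partial R D increment_square r s u0 r0 rs.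
set w := weighted_series _ _ in wi wp.
pose inc n (x : measurableTypeR R) := smoothed_count b n.+1 x - smoothed_count b n x.
pose g (x : measurableTypeR R) := (1 + 2^-1 * (1 - s)^-1) + 2^-1 * fine (w x).
have sums n : \sum_(0 <= i < n) s ^+ i <= (1 - s)^-1.
  have := @geometric_le_lim R n 1 s ler01 s0; rewrite ger0_norm ?(ltW s0) // mul1r => /(_ s1).
  rewrite /series /= (eq_bigr (fun i => s ^+ i)) // => i _; exact: mul1r.
have amgm x n : D x -> w x \is a fin_num -> \sum_(0 <= i < n) `|inc i x| <= g x - 1.
  move=> Dx wx.
  apply: (@le_trans _ _ (\sum_(0 <= i < n) 2^-1 * (s ^+ i + s ^- i * increment_square i x))).
    apply: ler_sum => i _.
    have si : 0 < s ^+ i by rewrite exprn_gt0.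
    rewrite /increment_square -/(inc i x) -(@real_normK _ (inc i x)) ?num_real //.
    move: `|inc i x| (normr_ge0 (inc i x)) => d d0.
    have -> : s ^+ i + s ^- i * d ^+ 2 = s ^- i * (s ^+ i - d) ^+ 2 + 2 * d.
      by field; rewrite gt_eqF.
    have : 0 <= s ^- i * (s ^+ i - d) ^+ 2 by rewrite mulr_ge0 ?sqr_ge0 // invr_ge0 ltW.
    lra.
  rewrite -mulr_sumr big_split /=.
  have := sums n; have := wp n x Dx wx; rewrite /g; lra.
have telescope x n : smoothed_count b n x = smoothed_count b 0 x + \sum_(0 <= i < n) inc i x.
  by rewrite telescope_sumr // addrC subrK.
have start x : smoothed_count b 0 x <= 1.
  rewrite /smoothed_count /= expr0 !mul1r subr0 /half_open.
  have : ((0 <= x)%R%:R : R) <= 1 by case: (0 <= x).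
  by have := ler0n R ((b - 1)^-1 <= x)%R; lra.
have aew := integrable_ae mD wi.
exists g; split.
- have i1 : mu.-integrable D (EFin \o fun=> 1 + 2^-1 * (1 - s)^-1).
    by apply: continuous_compact_integrable; [exact: segment_compact|move=> ?; exact: cvg_cst].
  have i2 : mu.-integrable D (EFin \o fun x => fine (w x)).
    have mw := measurable_int _ wi.
    apply: (le_integrable mD _ _ wi).
      by apply/measurable_EFinP; apply: (measurableT_comp _ mw).
    by move=> x _ /=; case: (w x) => [v||] //=; rewrite normr0 ?leey // lee_fin.
  have i3 := integrableZl mD 2^-1 i2.
  have := integrableD mD i1 i3; apply: eq_integrable => // x _.
- move: aew; apply: (@filterS _ _ (ae_filter_ringOfSetsType mu)) => x wx Dx n.
  have := amgm x n Dx (wx Dx); rewrite telescope; have := start x.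
  have : \sum_(0 <= i < n) inc i x <= \sum_(0 <= i < n) `|inc i x|.
    by apply: ler_sum => i _; exact: ler_norm.
  lra.
- move: aew; apply: (@filterS _ _ (ae_filter_ringOfSetsType mu)) => x wx Dx.
  have cn : cvgn [normed series (fun i => inc i x)].
    apply: nondecreasing_is_cvgn.
      by apply: nondecreasing_series => i _ _; exact: normr_ge0.
    exists (g x - 1) => _ [n _ <-]; exact: amgm (wx Dx).
  have /cvg_ex[l hl] := normed_cvg cn.
  apply: (@cvg_limit_density x (smoothed_count b 0 x + l)).
  rewrite (_ : (fun n => smoothed_count b n x) =
      fun n => smoothed_count b 0 x + series (fun i => inc i x) n).
    by apply: cvgD; [exact: cvg_cst|exact: hl].
  by apply/funext => n; rewrite telescope.
Qed.

Lemma ae_cvg_limit_density :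
  {ae mu, forall x, smoothed_count b n x @[n --> \oo] --> limit_density x}.
Proof.
have [g [_ _]] := smoothed_count_converges.
apply: (@filterS _ _ (ae_filter_ringOfSetsType mu)) => x h.
have [Dx|nD] := pselect (D x); first exact: h.
apply: (@cvg_limit_density x 0).
rewrite (_ : (fun n => smoothed_count b n x) = fun=> 0); first exact: cvg_cst.
apply/funext => n; apply: smoothed_count_out.
have [x0|x0] := ltP x 0; first by left.
right; rewrite leNgt; apply/negP => xL; apply: nD.
by rewrite /D /= in_itv /= x0 ltW.
Qed.

Lemma cvg_integral_limit_density (A : set (measurableTypeR R)) :
  measurable A -> A `<=` D ->
  (\int[mu]_(x in A) (smoothed_count b n x)%:E)%E @[n --> \oo] -->
  (\int[mu]_(x in A) (limit_density x)%:E)%E.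
Proof.
move=> mA AD; have [g [gi gb gc]] := smoothed_count_converges.
have [|||||_ _] := @dominated_convergence _ _ _ mu A mA
   (fun n x => (smoothed_count b n x)%:E) (fun x => (limit_density x)%:E) (EFin \o g).
- by move=> n; apply/measurable_EFinP; apply: measurable_funTS; exact: measurable_smoothed_count.
- by apply/measurable_EFinP; apply: measurable_funTS; exact: measurable_limit_density.
- move: gc; apply: (@filterS _ _ (ae_filter_ringOfSetsType mu)) => x h Ax.
  by apply: cvg_EFin; [exact: nearW|apply: h; exact: AD].
- by apply: (integrableS _ mA AD gi); exact: measurable_itv.
- move: gb; apply: (@filterS _ _ (ae_filter_ringOfSetsType mu)) => x h n Ax.
  by rewrite lee_fin /= ger0_norm ?smoothed_count_ge0 // h //; exact: AD.
exact.
Qed.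

End smoothed_counts.

(** * Measures on the line, cylinders and the projection *)

Section density_measure.
Context d (T : measurableType d) (R : realType).
Variables (P : {measure set T -> \bar R}) (h : T -> R).
Hypotheses (mh : measurable_fun setT h) (h_ge0 : forall x, 0 <= h x).

(** The measure with density [h] with respect to [P]. *)
Definition density_measure (A : set T) : \bar R := (\int[P]_(x in A) (h x)%:E)%E.

Let density0 : density_measure set0 = 0%E.
Proof. by rewrite /density_measure integral_set0. Qed.

Let density_ge0 A : (0 <= density_measure A)%E.
Proof. by apply: integral_ge0 => x _; rewrite lee_fin. Qed.

Let density_sigma_additive : semi_sigma_additive density_measure.
Proof.
move=> F mF tF mUF; rewrite /density_measure; apply: cvg_toP.
  apply: ereal_nondecreasing_is_cvgn => m n mn.
  by apply: lee_sum_nneg_natr => // k _ _; exact: density_ge0.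
rewrite ge0_integral_bigcup //.
- by apply/measurable_EFinP; apply: measurable_funTS.
- by move=> x _; rewrite lee_fin.
Qed.

HB.instance Definition _ := isMeasure.Build _ _ _ density_measure
  density0 density_ge0 density_sigma_additive.

Definition density_measure_of : {measure set T -> \bar R} := density_measure.

End density_measure.

Section rays.
Context {R : realType}.

(** The strict inequality [x < y] in the hypothesis is absorbed by writing an open ray as an
    increasing union of closed ones. *)
Lemma ray_le (m1 m2 : {measure set (measurableTypeR R) -> \bar R}) (L : R) :
  m1 setT = L%:E -> m2 setT = L%:E ->
  (forall x y : R, x < y -> (m2 `]-oo, x]%classic <= m1 `]-oo, y]%classic)%E) ->
  forall x : R, (m1 `]x, +oo[%classic <= m2 `]x, +oo[%classic)%E.
Proof.
move=> t1 t2 h x.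
have split_ray (m : {measure set (measurableTypeR R) -> \bar R}) (y : R) :
    m setT = L%:E -> (m `]-oo, y]%classic + m `]y, +oo[%classic)%E = L%:E.
  move=> mT; rewrite -measureU //; last by rewrite -setCitvl setICr.
  by rewrite -setCitvl setUv.
have step (y : R) : x < y -> (m1 `]y, +oo[%classic <= m2 `]x, +oo[%classic)%E.
  move=> xy; have e1 := split_ray m1 y t1; have e2 := split_ray m2 x t2.
  have le := h _ _ xy.
  have p1 := measure_ge0 m1 `]-oo, y]%classic.
  have p2 := measure_ge0 m2 `]-oo, x]%classic.
  have p3 := measure_ge0 m1 `]y, +oo[%classic.
  have p4 := measure_ge0 m2 `]x, +oo[%classic.
  move: e1 e2 le p1 p2 p3 p4.
  move: (m1 `]-oo, y]%classic) (m2 `]-oo, x]%classic)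
    (m1 `]y, +oo[%classic) (m2 `]x, +oo[%classic) => [u||] [v||] [u'||] [v'||] //=.
  rewrite -!EFinD !lee_fin => -[e1] [e2] *; lra.
rewrite (itvoyEbigcup x).
have cv : (m1 \o (fun k => `[x + k.+1%:R^-1, +oo[%classic)) @ \oo -->
    m1 (\bigcup_k `[x + k.+1%:R^-1, +oo[%classic).
  apply: nondecreasing_cvg_mu => //.
    by apply: bigcupT_measurable => k; exact: measurable_itv.
  move=> i j ij; apply/subsetPset => y /=; rewrite !in_itv /= !andbT.
  by apply: le_trans; rewrite lerD2l lef_pV2 ?posrE ?ltr0n ?ler_nat.
rewrite -(cvg_lim _ cv) //; apply: lime_le; first by apply/cvg_ex; eexists; exact: cv.
apply: nearW => k /=; rewrite -itvoyEbigcup.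
have k0 : 0 < k.+1%:R^-1 :> R by rewrite invr_gt0.
apply: (le_trans _ (step (x + k.+1%:R^-1 / 2) _)); last by rewrite ltrDl divr_gt0.
apply: le_measure; rewrite ?inE //.
by move: k0; move: (k.+1%:R^-1) => e e0 y /=; rewrite !in_itv /= !andbT => h1; lra.
Qed.

Lemma measure_eq_of_rays (m1 m2 : {measure set (measurableTypeR R) -> \bar R}) (L : R) :
  m1 setT = L%:E -> m2 setT = L%:E ->
  (forall x y : R, x < y -> (m2 `]-oo, x]%classic <= m1 `]-oo, y]%classic)%E) ->
  (forall x y : R, x < y -> (m1 `]-oo, x]%classic <= m2 `]-oo, y]%classic)%E) ->
  forall A, measurable A -> m1 A = m2 A.
Proof.
move=> t1 t2 h1 h2 A mA.
have := @measure_unique _ R (measurableTypeR R) (@RGenOInfty.G R) (fun k => `](- k%:R)%R, +oo[%classic) _ _ _ _ m1 m2 _ _ A mA; apply.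
- exact: RGenOInfty.measurableE.
- move=> _ _ [x ->] [y ->]; exists (Num.max x y).
  by apply/seteqP; split => z /=; rewrite !in_itv /= !andbT gt_max => /andP.
- by move=> k; eexists.
- apply/seteqP; split => // x _; have := archi_boundP (normr_ge0 x) => hx.
  exists (Num.bound `|x|) => //=; rewrite in_itv /= andbT ltrNl.
  by apply: le_lt_trans hx; rewrite -normrN ler_norm.
- move=> _ [x ->]; apply/eqP; rewrite eq_le.
  by rewrite (ray_le t1 t2 h1) (ray_le t2 t1 h2).
- move=> k; apply: (@le_lt_trans _ _ (m1 setT)); last by rewrite t1 ltry.
  by apply: le_measure; rewrite ?inE.
Qed.

End rays.

Section bernoulli_words.
Context {R : realType}.
Variables (m : probability digits R) (hm : is_bernoulli_half m).

Definition prefix_word n (a : digits) : n.-tuple bool := [tuple a i | i < n].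

Lemma cylinderE n (w : n.-tuple bool) :
  cylinder w = [set a : digits | prefix_word n a = w].
Proof.
apply/seteqP; split => [a ha|a <-] /=.
  by apply: eq_from_tnth => i; rewrite tnth_mktuple ha.
by move=> i; rewrite tnth_mktuple.
Qed.

Lemma measurable_cylinder n (w : n.-tuple bool) :
  measurable (cylinder w : set digits).
Proof. by apply: sub_sigma_algebra; exists n, w. Qed.

Lemma prefix_eventE n (P : pred (n.-tuple bool)) :
  [set a : digits | P (prefix_word n a)] = \bigcup_(w in [set` P]) cylinder w.
Proof.
apply/seteqP; split => [a Pa|a [w Pw]] /=.
  by exists (prefix_word n a) => //; rewrite cylinderE.
by rewrite cylinderE => /= ->.
Qed.

Lemma measurable_prefix_event n (P : pred (n.-tuple bool)) :
  measurable [set a : digits | P (prefix_word n a)].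
Proof.
rewrite prefix_eventE; apply: fin_bigcup_measurable => //.
by move=> w _; exact: measurable_cylinder.
Qed.

Lemma bernoulli_prefix_event n (P : pred (n.-tuple bool)) :
  m [set a : digits | P (prefix_word n a)] =
  (\sum_(w : n.-tuple bool | P w) 2^-1 ^+ n)%:E.
Proof.
rewrite prefix_eventE measure_fin_bigcup //; last 2 first.
- move=> w w' _ _ [a [] /=]; rewrite !cylinderE /= => <- <- //.
- by move=> w _; exact: measurable_cylinder.
rewrite -(bigfs _ (index_enum_uniq _)); last first.
  by move=> w _; rewrite mem_index_enum.
rewrite -sumEFin; apply: eq_bigr => w _; exact: hm.
Qed.

End bernoulli_words.

Section projection.
Context {R : realType}.
Variables (b : R) (b1 : 1 < b).

Definition partial_point n (a : digits) : R := \sum_(0 <= i < n) (a i)%:R * b ^- i.+1.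

(** The point [x] at which the branch [w] vanishes, that is the finite expansion with digits
    [w]. *)
Definition word_point n (w : n.-tuple bool) : R := - (b ^- n * Tword b w 0).

Lemma Tword_word_point n (w : n.-tuple bool) x :
  Tword b w x = b ^+ n * (x - word_point w).
Proof.
have b0 : b != 0 by have h := b1; rewrite gt_eqF //; lra.
have lin (s : seq bool) (u v : R) : Tword b s u - Tword b s v = b ^+ size s * (u - v).
  elim: s u v => [|a s IH] u v /=; first by rewrite expr0 mul1r.
  by rewrite /Tdigit IH exprSr; ring.
have := lin w x 0; rewrite size_tuple subr0 => /eqP; rewrite subr_eq => /eqP ->.
rewrite /word_point opprK mulrDr mulrA divff ?mul1r //.
by rewrite expf_neq0.
Qed.

Lemma word_point_prefix n (a : digits) :
  word_point (prefix_word n a) = partial_point n a.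
Proof.
have b0 : b != 0 by have h := b1; rewrite gt_eqF //; lra.
have valE : prefix_word n a = mkseq a n :> seq bool.
  apply: (@eq_from_nth _ false); rewrite ?size_tuple ?size_mkseq // => i hi.
  by rewrite nth_mkseq // -(tnth_nth false _ (Ordinal hi)) tnth_mktuple.
rewrite /word_point valE; suff -> : Tword b (mkseq a n) 0 = - (b ^+ n * partial_point n a).
  by rewrite mulrN opprK mulKf // expf_neq0.
elim: n {valE} => [|n IH].
  by rewrite /Tword /= /partial_point big_nil mulr0 oppr0.
rewrite mkseqS /Tword foldl_rcons -/(Tword _ _ _) IH /Tdigit /partial_point.
rewrite big_nat_recr //= exprS; field.
by rewrite expf_neq0 //= expf_neq0 // b0.
Qed.

Let L := (b - 1)^-1.

Let L_step : b * L = L + 1.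
Proof. by have h := b1; rewrite /L; field; rewrite gt_eqF //; lra. Qed.

Let b_gt0 : 0 < b. Proof. exact: lt_trans b1. Qed.

Let L_gt0 : 0 < L. Proof. by rewrite invr_gt0 subr_gt0. Qed.

(* Prefixes bound the point from both sides: [b L = L + 1] says that a further digit
   cannot move it beyond [partial_point n a + b^(- n) L]. *)
Let upper_point n a := partial_point n a + b ^- n * L.

Let partial_pointS n a : partial_point n.+1 a = partial_point n a + (a n)%:R * b ^- n.+1.
Proof. by rewrite /partial_point big_nat_recr. Qed.

Let partial_point_nd a : nondecreasing_seq (partial_point ^~ a).
Proof.
apply/nondecreasing_seqP => n; rewrite partial_pointS lerDl mulr_ge0 //.
by rewrite invr_ge0 exprn_ge0 // ltW.
Qed.

Let upper_point_ni a : nonincreasing_seq (upper_point ^~ a).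
Proof.
apply/nonincreasing_seqP => n; rewrite /upper_point partial_pointS -addrA lerD2l.
have p0 : 0 < b ^- n.+1 by rewrite invr_gt0 exprn_gt0.
have -> : b ^- n * L = b ^- n.+1 * (L + 1).
  by rewrite -L_step exprS; field; rewrite expf_neq0 gt_eqF.
have : ((a n)%:R : R) <= 1 by case: (a n).
nra.
Qed.

Let partial_le_upper n k a : partial_point n a <= upper_point k a.
Proof.
have up j : partial_point j a <= upper_point j a.
  by rewrite lerDl mulr_ge0 ?(ltW L_gt0) // invr_ge0 exprn_ge0 // ltW.
have [nk|kn] := leqP n k.
  by apply: le_trans (up k); exact: partial_point_nd.
by apply: le_trans (up n) _; apply: upper_point_ni; exact: ltnW.
Qed.

Lemma cvg_partial_point a : partial_point n a @[n --> \oo] --> pibeta b a.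
Proof.
apply: nondecreasing_is_cvgn; first exact: partial_point_nd.
by exists (upper_point 0 a) => _ [n _ <-]; exact: partial_le_upper.
Qed.

Lemma partial_point_le n a : partial_point n a <= pibeta b a.
Proof.
have cv : cvgn (partial_point ^~ a) by apply/cvg_ex; exists (pibeta b a); exact: cvg_partial_point.
exact: (nondecreasing_cvgn_le (partial_point_nd a) cv).
Qed.

Lemma pibeta_le n a : pibeta b a <= partial_point n a + b ^- n * (b - 1)^-1.
Proof.
have cv : cvgn (partial_point ^~ a) by apply/cvg_ex; exists (pibeta b a); exact: cvg_partial_point.
by apply: limr_le => //; apply: nearW => k; exact: partial_le_upper.
Qed.

Lemma measurable_digit i : measurable_fun setT (fun a : digits => (a i)%:R : R).
Proof.
have mt : measurable [set a : digits | a i].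
  have := @measurable_prefix_event i.+1 (fun w => tnth w ord_max).
  by congr (measurable _); apply/seteqP; split => a /=; rewrite tnth_mktuple.
rewrite (_ : (fun _ => _) = \1_[set a : digits | a i]); first exact: measurable_indic.
apply/funext => a; rewrite indicE; congr ((nat_of_bool _)%:R).
by apply/idP/idP => [h|]; rewrite inE.
Qed.

Lemma measurable_pibeta : measurable_fun setT (pibeta b : digits -> measurableTypeR R).
Proof.
apply: (@measurable_fun_cvg _ _ _ _ partial_point) => [n|a _].
  elim: n => [|n IH].
    rewrite (_ : partial_point 0 = fun=> 0) //.
    by apply/funext => a; rewrite /partial_point big_nil.
  rewrite (_ : partial_point n.+1 = fun a => partial_point n a + (a n)%:R * b ^- n.+1).
    apply: measurable_funD => //; apply: measurable_funM => //; exact: measurable_digit.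
  by apply/funext => a; exact: partial_pointS.
exact: cvg_partial_point.
Qed.

End projection.

(** * The limit is the density *)

Section comparison.
Context {R : realType}.
Local Notation mu := (@lebesgue_measure R).
Variables (m : probability digits R) (hm : is_bernoulli_half m).
Variables (b : R) (b1 : 1 < b).

Let L := (b - 1)^-1.
Let L_gt0 : 0 < L. Proof. by rewrite invr_gt0 subr_gt0. Qed.
Let b_gt0 : 0 < b. Proof. exact: lt_trans b1. Qed.
Let D : set (measurableTypeR R) := `[0, L]%classic.

(** The distribution function of the finite expansions with [n] digits. *)
Definition prefix_weight n (c : R) : R :=
  \sum_(w : n.-tuple bool) (word_point b w <= c)%R%:R * 2^-1 ^+ n.

(** The part of the normalised count that comes from words with their point left of [c]. Its
    integral is computed exactly, and it lies between the counts on slightly different rays. *)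
Definition left_count n (c x : R) : R :=
  (b / 2) ^+ n * \sum_(w : n.-tuple bool)
    (word_point b w <= c)%R%:R * half_open b (Tword b w x).

Lemma half_open_word n (w : n.-tuple bool) x : half_open b (Tword b w x) =
  (word_point b w <= x)%R%:R - (word_point b w + b ^- n * L <= x)%R%:R.
Proof.
have bn : 0 < b ^+ n by rewrite exprn_gt0.
rewrite Tword_word_point // /half_open -/L; congr ((nat_of_bool _)%:R - (nat_of_bool _)%:R).
  by rewrite pmulr_rge0 // subr_ge0.
by rewrite mulrC -ler_pdivrMr // lerBrDl mulrC.
Qed.

Lemma integrates_left_count n c : integrates (left_count n c) (L * prefix_weight n c).
Proof.
have bn : 0 < b ^+ n by rewrite exprn_gt0.
have h (w : n.-tuple bool) : integrates
    (fun x => (word_point b w <= c)%R%:R * half_open b (Tword b w x))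
    ((word_point b w <= c)%R%:R * (b ^- n * L)).
  apply: integratesZ.
  have := @integrates_itv R (word_point b w) (word_point b w + b ^- n * L).
  rewrite lerDl addrAC subrr add0r mulr_ge0 ?(ltW L_gt0) ?invr_ge0 ?(ltW bn) // => /(_ isT).
  by apply: eq_integrates => x; rewrite half_open_word.
have := integratesZ ((b / 2) ^+ n) (integrates_sum (index_enum _) h).
rewrite (_ : (b / 2) ^+ n * _ = L * prefix_weight n c) //.
rewrite /prefix_weight !mulr_sumr; apply: eq_bigr => w _.
by rewrite exprMn; field; rewrite gt_eqF.
Qed.

Lemma left_count_le n c x : left_count n c x <= smoothed_count b n x.
Proof.
rewrite smoothed_count_words; apply: ler_wpM2l.
  by rewrite exprn_ge0 // divr_ge0 // ltW.
apply: ler_sum => w _; rewrite ler_piMl ?half_open_ge0 //.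
by case: (_ <= c).
Qed.

Lemma left_count_ge0 n c x : 0 <= left_count n c x.
Proof.
rewrite mulr_ge0 ?exprn_ge0 ?divr_ge0 ?(ltW b_gt0) //.
by apply: sumr_ge0 => w _; rewrite mulr_ge0 ?half_open_ge0.
Qed.

Lemma smoothed_count_le_left n c x : x <= c -> smoothed_count b n x <= left_count n c x.
Proof.
move=> xc; rewrite smoothed_count_words; apply: ler_wpM2l.
  by rewrite exprn_ge0 // divr_ge0 // ltW.
apply: ler_sum => w _; have [wc|cw] := leP (word_point b w) c; first by rewrite mul1r.
have xw := le_lt_trans xc cw.
have wn : 0 < b ^- n * L by rewrite mulr_gt0 // invr_gt0 exprn_gt0.
have xw' : x < word_point b w + b ^- n * L by lra.
by rewrite mul0r half_open_word (leNgt (word_point b w)) xw (leNgt (word_point b w + b ^- n * L)) xw' subrr.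
Qed.

Lemma left_count_out n c x : c + b ^- n * L <= x -> left_count n c x = 0.
Proof.
move=> cx; rewrite /left_count big1 ?mulr0 // => w _.
have [wc|cw] := leP (word_point b w) c; last by rewrite mul0r.
have wn : 0 < b ^- n * L by rewrite mulr_gt0 // invr_gt0 exprn_gt0.
have h : word_point b w + b ^- n * L <= x by apply: le_trans cx; rewrite lerD2r.
rewrite half_open_word h (le_trans _ h) ?subrr ?mulr0 //.
by rewrite lerDl ltW.
Qed.

Let A (c : R) : set (measurableTypeR R) := D `&` `]-oo, c]%classic.

Let mD : measurable D. Proof. exact: measurable_itv. Qed.

Let mA c : measurable (A c).
Proof. by apply: measurableI => //; exact: measurable_itv. Qed.

Let mf n B : measurable_fun B (fun x : measurableTypeR R => (smoothed_count b n x)%:E).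
Proof. by apply/measurable_EFinP; apply: measurable_funTS; exact: measurable_smoothed_count. Qed.

Let ml n c : measurable_fun setT (fun x : measurableTypeR R => (left_count n c x)%:E).
Proof. by have [li _] := integrates_left_count n c; exact: measurable_int li. Qed.

(** A word with point at most [c'] counts on an interval that lies entirely left of [c]. *)
Lemma prefix_weight_le_integral n (c c' : R) : c' + b ^- n * L <= c ->
  ((L * prefix_weight n c')%:E <= \int[mu]_(x in A c) (smoothed_count b n x)%:E)%E.
Proof.
move=> cc; have [_ <-] := integrates_left_count n c'.
apply: (@le_trans _ _ (\int[mu]_(x in A c) (left_count n c' x)%:E)%E).
  rewrite le_eqVlt; apply/orP; left; apply/eqP; rewrite [RHS]integral_mkcond.
  apply: eq_integral => x _; rewrite patchE; case: ifPn => // /negP; rewrite inE => nA.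
  congr (_%:E); apply/eqP; rewrite eq_le left_count_ge0 andbT.
  have [cx|xc] := ltP c x; first by rewrite left_count_out // (le_trans cc) // ltW.
  apply: le_trans (left_count_le _ _ _) _; rewrite smoothed_count_out //.
  have [x0|x0] := ltP x 0; first by left.
  right; rewrite leNgt; apply/negP => xL; apply: nA.
  by rewrite /A /D /=; split => /=; rewrite in_itv //= x0 ltW.
apply: ge0_le_integral => //.
- by move=> x _; rewrite lee_fin left_count_ge0.
- exact: measurable_funTS.
- by move=> x _; rewrite lee_fin left_count_le.
Qed.

(** Only words with point at most [c] count at some [x <= c]. *)
Lemma integral_le_prefix_weight n (c : R) :
  (\int[mu]_(x in A c) (smoothed_count b n x)%:E <= (L * prefix_weight n c)%:E)%E.
Proof.
have [_ <-] := integrates_left_count n c.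
apply: (@le_trans _ _ (\int[mu]_(x in A c) (left_count n c x)%:E)%E).
  apply: ge0_le_integral => //.
  - by move=> x _; rewrite lee_fin smoothed_count_ge0.
  - exact: measurable_funTS.
  - move=> x [_ /=]; rewrite in_itv /= => xc.
    by rewrite lee_fin smoothed_count_le_left.
apply: ge0_subset_integral => //.
by move=> x _; rewrite lee_fin left_count_ge0.
Qed.

Local Notation nu := (bernoulli_convolution m b).

Let prefix_weightE n c :
  m [set a : digits | (word_point b (prefix_word n a) <= c)%R] = (prefix_weight n c)%:E.
Proof.
rewrite (bernoulli_prefix_event hm (fun w => word_point b w <= c)); congr (_%:E).
rewrite big_mkcond; apply: eq_bigr => w _.
by case: (_ <= c); rewrite ?mul1r ?mul0r.
Qed.

Let m_ray (c : R) : measurable (pibeta b @^-1` `]-oo, c]%classic).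
Proof.
by rewrite -[X in measurable X]setTI; apply: (measurable_pibeta b1).
Qed.

Lemma convolution_le_prefix_weight n c : (nu `]-oo, c]%classic <= (prefix_weight n c)%:E)%E.
Proof.
rewrite -prefix_weightE /bernoulli_convolution /pushforward.
apply: le_measure; rewrite ?inE //.
  exact: (measurable_prefix_event (fun w => word_point b w <= c)).
move=> a /=; rewrite in_itv /= word_point_prefix //.
by apply: le_trans; exact: partial_point_le.
Qed.

Lemma prefix_weight_le_convolution n c :
  ((prefix_weight n c)%:E <= nu `]-oo, (c + b ^- n * L)%R]%classic)%E.
Proof.
rewrite -prefix_weightE /bernoulli_convolution /pushforward.
apply: le_measure; rewrite ?inE //.
  exact: (measurable_prefix_event (fun w => word_point b w <= c)).
move=> a /=; rewrite in_itv /= word_point_prefix // => h.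
by apply: le_trans (pibeta_le b1 n a) _; rewrite lerD2r.
Qed.

Let small_scale (e : R) : 0 < e -> \forall n \near \oo, b ^- n * L <= e.
Proof.
move=> e0.
have : (L * (b^-1) ^+ n) @[n --> \oo] --> (0 : R).
  apply: (@cvg_geometric R L b^-1).
  by rewrite ger0_norm ?invr_ge0 ?ltW // invf_lt1.
move=> /cvgr_le/(_ _ e0); apply: filterS => n.
by rewrite exprVn mulrC.
Qed.

Hypothesis hinc : exponential_increments b.

Let h := limit_density b.

Let limit_A c : (\int[mu]_(x in A c) (smoothed_count b n x)%:E)%E @[n --> \oo] -->
  (\int[mu]_(x in A c) (h x)%:E)%E.
Proof. by apply: (cvg_integral_limit_density b1 hinc) => //; exact: subIsetl. Qed.

(** The discrepancy [b^(- n) L] between the endpoints tends to 0, whence the strict inequality. *)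
Lemma convolution_le_limit (c c' : R) : c' < c ->
  (L%:E * nu `]-oo, c']%classic <= \int[mu]_(x in A c) (h x)%:E)%E.
Proof.
move=> cc; rewrite -(cvg_lim _ (@limit_A c)) //.
apply: lime_ge; first by apply/cvg_ex; eexists; exact: limit_A.
have cc0 : 0 < c - c' by rewrite subr_gt0.
apply: filterS (small_scale cc0) => n hn.
apply: (@le_trans _ _ (L * prefix_weight n c')%:E); last first.
  by apply: prefix_weight_le_integral; lra.
rewrite EFinM; apply: lee_wpmul2l; first by rewrite lee_fin ltW.
exact: convolution_le_prefix_weight.
Qed.

Lemma limit_le_convolution (c c' : R) : c < c' ->
  (\int[mu]_(x in A c) (h x)%:E <= L%:E * nu `]-oo, c']%classic)%E.
Proof.
move=> cc; rewrite -(cvg_lim _ (@limit_A c)) //.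
apply: lime_le; first by apply/cvg_ex; eexists; exact: limit_A.
have cc0 : 0 < c' - c by rewrite subr_gt0.
apply: filterS (small_scale cc0) => n hn.
apply: le_trans (integral_le_prefix_weight n c) _.
rewrite EFinM; apply: lee_wpmul2l; first by rewrite lee_fin ltW.
apply: le_trans (prefix_weight_le_convolution n c) _.
rewrite /bernoulli_convolution /pushforward; apply: le_measure; rewrite ?inE; [exact: m_ray|exact: m_ray|].
by move=> a /=; rewrite !in_itv /= => /le_trans; apply; lra.
Qed.

Lemma total_limit : (\int[mu]_(x in D) (h x)%:E)%E = L%:E.
Proof.
have cv := cvg_integral_limit_density b1 hinc mD (@subset_refl _ D).
rewrite -(cvg_lim _ cv) // (_ : (fun _ => _) = fun=> L%:E); first exact: lim_cst.
apply/funext => n; have [_ <-] := integrates_smoothed_count b1 n.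
rewrite integral_mkcond; apply: eq_integral => x _; rewrite patchE.
case: ifPn => // /negP; rewrite inE => nD; rewrite smoothed_count_out //.
have [x0|x0] := ltP x 0; first by left.
right; rewrite leNgt; apply/negP => xL; apply: nD.
by rewrite /D /= in_itv /= x0 ltW.
Qed.

Lemma uniform_integral (B : set (measurableTypeR R)) : measurable B ->
  (\int[lebesgue_Ibeta b1]_(x in B) (h x)%:E = L^-1%:E * \int[mu]_(x in D `&` B) (h x)%:E)%E.
Proof.
move=> mB; rewrite integral_mkcond integral_uniform; last 2 first.
- apply/(measurable_restrictT _ mB).
  by apply/measurable_EFinP; apply: measurable_funTS; exact: measurable_limit_density.
- by move=> x; apply: erestrict_ge0 => y _; rewrite lee_fin limit_density_ge0.
by rewrite subr0 integral_mkcondr.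
Qed.

(** The two measures have the same total mass and their distribution functions interlace. *)
Lemma limit_density_is_density :
  is_density nu (lebesgue_Ibeta b1) h.
Proof.
have mh : measurable_fun setT h := measurable_limit_density b.
have h0 x : 0 <= h x := limit_density_ge0 b1 x.
split => // B mB.
have mp := measurable_pibeta b1.
pose X : {mfun digits >-> measurableTypeR R} :=
  HB.pack (pibeta b) (isMeasurableFun.Build _ _ digits (measurableTypeR R) (pibeta b) mp).
have LN0 : L != 0 by rewrite gt_eqF.
have LL (y : \bar R) : (L^-1%:E * (L%:E * y) = y)%E.
  by rewrite muleA -EFinM mulVf // mul1e.
have iL0 : (0 <= L^-1%:E)%E by rewrite lee_fin invr_ge0 ltW.
have := @measure_eq_of_rays R (distribution m X)
  (density_measure_of (lebesgue_Ibeta b1) mh h0) 1.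
apply => //.
- exact: probability_setT.
- rewrite /density_measure_of /= /density_measure uniform_integral //.
  by rewrite setIT total_limit -EFinM mulVf.
- move=> x y xy; rewrite /density_measure_of /= /density_measure uniform_integral //.
  rewrite -[leRHS]LL; apply: lee_wpmul2l => //; exact: limit_le_convolution.
- move=> x y xy; rewrite /density_measure_of /= /density_measure uniform_integral //.
  rewrite -[leLHS]LL; apply: lee_wpmul2l => //; exact: convolution_le_limit.
Qed.

End comparison.

(** There are countably many words, and each excludes one point. *)
Lemma ae_Tword_neq (R : realType) (b : R) : 1 < b ->
  {ae @lebesgue_measure R, forall x, forall w : seq bool, Tword b w x != (b - 1)^-1}.
Proof.
move=> b1.
have one (w : seq bool) : {ae @lebesgue_measure R, forall x, Tword b w x != (b - 1)^-1}.
  exists [set word_point b (in_tuple w) + b ^- size w * (b - 1)^-1]; split.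
  - exact: measurable_set1.
  - exact: lebesgue_measure_set1.
  - move=> x /= /negP; rewrite negbK => /eqP.
    have -> : Tword b w x = Tword b (in_tuple w) x by [].
    rewrite Tword_word_point // => <-.
    by rewrite mulKf ?expf_neq0 ?gt_eqF ?(lt_trans ltr01) // addrC subrK.
have all_codes : {ae @lebesgue_measure R, forall x, forall n : nat, forall w : seq bool,
    unpickle n = Some w -> Tword b w x != (b - 1)^-1}.
  apply: ae_foralln => n; case E : (unpickle n) => [w|]; last exact: aeW.
  have := one w; apply: (@filterS _ _ (ae_filter_ringOfSetsType _)) => x hx w' [<-].
  exact: hx.
move: all_codes; apply: (@filterS _ _ (ae_filter_ringOfSetsType _)) => x hx w.
exact: (hx (pickle w) w (pickleK w)).
Qed.

Theorem proposition5p1 (R : realType) (m : probability digits R)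
    (hm : is_bernoulli_half m) :
  {ae @lebesgue_measure R, forall b : R,
    forall b1 : 1 < b, b < Num.sqrt 2 ->
    exists h : measurableTypeR R -> R,
      is_density (bernoulli_convolution m b) (lebesgue_Ibeta b1) h /\
      {ae @lebesgue_measure R, forall x : R, x \in Ibeta b ->
        (b / 2) ^+ n * (size (Obeta b n x))%:R @[n --> \oo] --> h x}}.
Proof.
have := @ae_exponential_increments R.
apply: (@filterS _ _ (ae_filter_ringOfSetsType _)) => b hb b1 bs.
have hinc : exponential_increments b by apply: hb; rewrite b1 bs.
exists (limit_density b); split; first exact: limit_density_is_density.
have h1 := ae_cvg_limit_density b1 hinc; have h2 := ae_Tword_neq b1.
apply: (@filterS2 _ _ (ae_filter_ringOfSetsType _) _ _ _ _ h1 h2) => x cx wx _.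
rewrite (_ : (fun n => _) = fun n => smoothed_count b n x) //.
by apply/funext => n; rewrite size_Obeta_smoothed.
Qed.
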